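(* Let $n\ge 1$, let $a,b\ge 0$ be computable reals, let $x_0\ne y_0$ be computable points of $\mathbb R^n$, and consider the game $\Gamma(a,b,\mathbb R^n)$. If $a\le b$, then Evader has an open-loop computable winning strategy. If $a>b$, then Pursuer has a positional computable winning strategy.
   Context: The game $\Gamma(a,b,\mathbb R^n)$: Pursuer's position $x(t)$ and Evader's position $y(t)$ move in $\mathbb R^n$ according to $\dot x=u$, $x(0)=x_0$, and $\dot y=v$, $y(0)=y_0$, where the controls are computable functions with $|u|\le a$ (the class $C_P$) and $|v|\le b$ (the class $C_E$); $|\cdot|$ is the Euclidean norm. The goal of Pursuer is exact catch. A strategy of Pursuer in $C_P$ is winning if for all $v\in C_E$ there is a time $t\ge 0$ (depending on $v$) with $x(t)=y(t)$. A strategy of Evader in $C_E$ is winning if for all $u\in C_P$ we have $x(t)\ne y(t)$ for all $t\ge 0$. The strategies of the opponent that are quantified over are control functions of time $t\in[0,\infty)$. A strategy is open-loop if the control depends only on the time $t$ (for a fixed game, including its initial positions). It is positional if the control at time $t$ depends only on $t$ and the current state $(x(t),y(t))$ of the system; since the game is over once $x(t)=y(t)$, a positional strategy of Pursuer only needs to be defined for states with $x\ne y$. A function $\phi:\mathbb N\to\mathbb Q^m$ represents $z\in\mathbb R^m$ if $|z-\phi(k)|\le 2^{-k}$ for all $k$; $z$ is computable if it has a computable representation. A function $f:X\to\mathbb R^m$, $X\subseteq\mathbb R^k$, is computable if some oracle Turing machine, given any representation of $z\in X$ as oracle, outputs for each $j$ a rational point within $2^{-j}$ of $f(z)$. *)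

(* Defs.v *)
From HB Require Import structures.
From mathcomp Require Import all_boot all_order all_algebra.
From mathcomp Require Import all_classical all_reals all_analysis.

Set Implicit Arguments.
Unset Strict Implicit.
Unset Printing Implicit Defensive.

Import Order.TTheory GRing.Theory Num.Theory.
Import numFieldNormedType.Exports.

Local Open Scope classical_set_scope.
Local Open Scope ring_scope.

(** * Oracle Turing machines

    Machines are deterministic, with finitely many two-way infinite tapes over
    the alphabet {false, true} plus a blank.  Words are bit strings. *)

Definition word := seq bool.
Definition symbol := option bool.   (* [None] is the blank *)

Variant move := MoveLeft | Stay | MoveRight.

(* [Tape l r]: the head scans the first symbol of [r]; [l] lists the cells to
   its left, nearest first.  All cells beyond [l] and [r] are blank. *)
Record tape := Tape { tleft : seq symbol; tright : seq symbol }.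

Definition scan (t : tape) : symbol := head None (tright t).

Definition write (s : symbol) (t : tape) : tape :=
  Tape (tleft t) (s :: behead (tright t)).

Definition shift (d : move) (t : tape) : tape :=
  match d with
  | MoveLeft => Tape (behead (tleft t)) (head None (tleft t) :: tright t)
  | Stay => t
  | MoveRight => Tape (scan t :: tleft t) (behead (tright t))
  end.

Definition tape_of_word (w : word) : tape := Tape [::] (map Some w).

(* The word that starts at the head and ends before the first blank. *)
Fixpoint read_cells (r : seq symbol) : word :=
  if r is Some b :: r' then b :: read_cells r' else [::].

Definition word_of_tape (t : tape) : word := read_cells (tright t).

(* [delta] is a finite table, as its domain is finite; [None] means halt.
   [query q = Some q'] makes [q] a query state with answer state [q']. *)
Record otm := OTM {
  state : finType;
  tapes : finType;
  start : state;
  io_tape : tapes;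
  oracle_tape : tapes;
  query : state -> option state;
  delta : state -> {ffun tapes -> symbol} ->
          option (state * {ffun tapes -> symbol * move}) }.

Definition config (M : otm) : Type := (state M * {ffun tapes M -> tape})%type.

Definition init (M : otm) (w : word) : config M :=
  (start M, [ffun i => tape_of_word (if i == io_tape M then w else [::])]).

(* An oracle call replaces the query word by the oracle's answer in one step. *)
Definition step (M : otm) (O : word -> word) (c : config M) :
    option (config M) :=
  if query c.1 is Some q then
    Some (q, [ffun i => if i == oracle_tape M
                        then tape_of_word (O (word_of_tape (c.2 i)))
                        else c.2 i])
  else
    if delta c.1 [ffun i => scan (c.2 i)] is Some (q, act) then
      Some (q, [ffun i => shift (act i).2 (write (act i).1 (c.2 i))])
    else None.

(* Started on [w], the machine [M] with oracle [O] halts with output [w']. *)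
Definition outputs (M : otm) (O : word -> word) (w w' : word) : Prop :=
  exists (k : nat) (c : config M),
    [/\ iter k (obind (step O)) (Some (init M w)) = Some c,
        step O c = None
      & word_of_tape (c.2 (io_tape M)) = w'].

Definition oracle_free (M : otm) : Prop := forall q : state M, query q = None.

(** * Codes of natural numbers and of rational points *)

Definition nat_code (k : nat) : word := nseq k true.

(* A sign bit, then the numerator and the denominator of the reduced fraction,
   each in unary and closed by [false]. *)
Definition rat_code (q : rat) : word :=
  (q < 0) :: nat_code `|numq q|%N ++ false :: nat_code `|denq q|%N ++ [:: false].

Definition ratpoint_code (m : nat) (q : 'rV[rat]_m) : word :=
  flatten [seq rat_code (q ord0 i) | i <- enum 'I_m].

(* The oracle given by a sequence of rational points: the query [nat_code k] is
   answered by the code of [phi k]. *)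
Definition seq_oracle (m : nat) (phi : nat -> 'rV[rat]_m) (w : word) : word :=
  ratpoint_code (phi (size w)).

Definition computable_seq (m : nat) (phi : nat -> 'rV[rat]_m) : Prop :=
  exists M : otm, oracle_free M /\
    forall k, outputs M (fun=> [::]) (nat_code k) (ratpoint_code (phi k)).

(** * Computable points and functions *)

(* The library norm on matrices is the sup norm, hence this definition. *)
Definition enorm (R : realType) (m : nat) (z : 'rV[R]_m) : R :=
  Num.sqrt (\sum_(i < m) z ord0 i ^+ 2).

Definition within_prec (R : realType) (m : nat) (z : 'rV[R]_m)
    (q : 'rV[rat]_m) (k : nat) : Prop :=
  enorm (z - map_mx ratr q) <= 2 ^- k.

Definition represents (R : realType) (m : nat) (phi : nat -> 'rV[rat]_m)
    (z : 'rV[R]_m) : Prop :=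
  forall k, within_prec z (phi k) k.

Definition computable_point (R : realType) (m : nat) (z : 'rV[R]_m) : Prop :=
  exists phi : nat -> 'rV[rat]_m, computable_seq phi /\ represents phi z.

Definition computable_real (R : realType) (r : R) : Prop :=
  computable_point (const_mx r : 'rV[R]_1).

(* [f] is regarded as a function on [X]; its values elsewhere are irrelevant. *)
Definition computable_on (R : realType) (k m : nat) (X : set 'rV[R]_k)
    (f : 'rV[R]_k -> 'rV[R]_m) : Prop :=
  exists M : otm, forall z : 'rV[R]_k, X z ->
    forall phi : nat -> 'rV[rat]_k, represents phi z ->
    forall j : nat, exists2 q : 'rV[rat]_m,
      outputs M (seq_oracle phi) (nat_code j) (ratpoint_code q)
      & within_prec (f z) q j.

(** * The game *)

(* The derivative of [x] at [t] relative to [D]; one-sided at an end point. *)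
Definition has_derivative_within (R : realType) (n : nat) (D : set R)
    (x : R -> 'rV[R]_n) (t : R) (d : 'rV[R]_n) : Prop :=
  ((s - t)^-1 *: (x s - x t)) @[s --> within D t^'] --> d.

(* The classes C_P and C_E: computable functions of time on [0, +oo[ with
   values of norm at most [c]. *)
Definition control (R : realType) (n : nat) (c : R) (u : R -> 'rV[R]_n) : Prop :=
  computable_on [set z : 'rV[R]_1 | 0 <= z ord0 ord0]
    (fun z => u (z ord0 ord0)) /\
  (forall t : R, 0 <= t -> enorm (u t) <= c).

(* x' = u on [0, +oo[ and x(0) = p.  A control is continuous, being computable,
   so it has exactly one trajectory on [0, +oo[. *)
Definition trajectory (R : realType) (n : nat) (p : 'rV[R]_n)
    (u x : R -> 'rV[R]_n) : Prop :=
  x 0 = p /\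
  (forall t : R, 0 <= t -> has_derivative_within `[0, +oo[ x t (u t)).

Definition evader_open_loop_winning (R : realType) (n : nat) (a b : R)
    (x0 y0 : 'rV[R]_n) (v : R -> 'rV[R]_n) : Prop :=
  control b v /\
  forall u : R -> 'rV[R]_n, control a u ->
  forall x y : R -> 'rV[R]_n, trajectory x0 u x -> trajectory y0 v y ->
  forall t : R, 0 <= t -> x t != y t.

(* A positional strategy of Pursuer assigns a control value to a time and a
   state [(x, y)] with [x != y]; to be computable it must be so as a function on
   a subset of R^(1 + n + n). *)
Definition positional_control (R : realType) (n : nat) (a : R)
    (U : R -> 'rV[R]_n -> 'rV[R]_n -> 'rV[R]_n) : Prop :=
  computable_on
    [set z : 'rV[R]_(1 + (n + n)) |
      0 <= lsubmx z ord0 ord0 /\ lsubmx (rsubmx z) != rsubmx (rsubmx z)]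
    (fun z => U (lsubmx z ord0 ord0) (lsubmx (rsubmx z)) (rsubmx (rsubmx z))) /\
  (forall (t : R) (x y : 'rV[R]_n), 0 <= t -> x != y -> enorm (U t x y) <= a).

(* [x] is Pursuer's trajectory up to time [T] when he uses [U] against Evader's
   trajectory [y], there being no catch before [T]. *)
Definition play_until (R : realType) (n : nat) (x0 : 'rV[R]_n)
    (U : R -> 'rV[R]_n -> 'rV[R]_n -> 'rV[R]_n) (y : R -> 'rV[R]_n)
    (T : R) (x : R -> 'rV[R]_n) : Prop :=
  [/\ x 0 = x0, {within `[0, T], continuous x}
    & forall t : R, 0 <= t < T ->
        x t != y t /\ has_derivative_within `[0, T] x t (U t (x t) (y t))].

(* Against every control of Evader the closed-loop system has a trajectory that
   reaches a catch, and up to the catch it is the only trajectory.  The second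
   part is what makes "the position x(t) under [U]" meaningful: no play of [U]
   avoids the catch, nor can a play stop short of it. *)
Definition pursuer_positional_winning (R : realType) (n : nat) (a b : R)
    (x0 y0 : 'rV[R]_n) (U : R -> 'rV[R]_n -> 'rV[R]_n -> 'rV[R]_n) : Prop :=
  positional_control a U /\
  forall v : R -> 'rV[R]_n, control b v ->
  forall y : R -> 'rV[R]_n, trajectory y0 v y ->
  exists (T : R) (x : R -> 'rV[R]_n),
    [/\ 0 <= T, play_until x0 U y T x, x T = y T
      & forall (T' : R) (x' : R -> 'rV[R]_n),
          0 <= T' -> play_until x0 U y T' x' ->
          T' <= T /\ (forall t : R, 0 <= t <= T' -> x' t = x t)].

(* Main.v *)
Require Import Defs.
From HB Require Import structures.
From mathcomp Require Import all_boot all_order all_algebra.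
From mathcomp Require Import all_classical all_reals all_analysis.
From mathcomp Require Import zify ring lra.

Import Order.TTheory GRing.Theory Num.Theory.
Import numFieldNormedType.Exports.

Local Open Scope ring_scope.

Set Implicit Arguments.
Unset Strict Implicit.
Unset Printing Implicit Defensive.

(* Evader moves with the constant velocity b e or - b e, where e is a coordinate
   vector along which y0 - x0 does not vanish and the sign is that of the
   coordinate: if |w| = b >= a and w . (y0 - x0) >= 0, then y0 + t w is farther
   than a t from x0.

   Pursuer chooses natural numbers m, K, T0 with b < (m - 1) / K, m / K <= a and
   K |y0 - x0| < T0, and uses U(t, x, y) = m s p / max(s^2, K^2 |p|^2), where
   p = y - x and s = max(0, T0 - t), so that |U| <= m / K.  As long as K |p| <= s
   the equation is the linear x' = (m / s) (y - x), which is solved by an integral,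
   and K |p| < s cannot fail first at a time t < T0 because there
   (K |p|)' <= K b - m < -1 = s'.  Hence a catch occurs at time T0 at the latest.

   U is a rational function with a maximum, so a machine can compute it from
   integer approximations of 2^N (t, x, y): it searches for an N at which the
   denominator is large compared with the error, and outputs odd multiples of a
   power of 1/2, which are reduced fractions.  Programs over stacks, closed under
   primitive recursion and minimization, are compiled to Turing machines. *)

(** * Programs on stacks of bits *)

(** The obvious law a p / |p| gives a nonlinear equation that is singular exactly at a catch, and
    its plays would need an existence and uniqueness theorem. The law m p / s gives a linear
    equation with explicit solutions, singular only at the known time T0. Alone it is neither
    bounded on all states nor defined for s = 0; the maximum in the denominator cures both and
    leaves the actual plays unchanged, since these stay where K |p| <= s. The unit in b < (m - 1) /
    K pays for the clock: s decreases at rate 1, so K |p| has to decrease faster than that whenever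
    it reaches s. Squares instead of norms and natural constants make the law free of roots, and the
    only inexact data of the machine are those of its oracle. The remaining difficulty is that the
    denominator may be arbitrarily small, so that no precision fixed in advance suffices; as x != y
    makes it positive, the search for N ends. Codes of rationals are reduced fractions, and odd
    numerators over powers of 2 avoid the computation of a common divisor. *)

Definition upd (T : Type) (f : nat -> T) (i : nat) (x : T) : nat -> T :=
  fun j => if j == i then x else f j.

Lemma updE (T : Type) (f : nat -> T) i x : upd f i x i = x.
Proof. by rewrite /upd eqxx. Qed.

Lemma updN (T : Type) (f : nat -> T) i x j : j != i -> upd f i x j = f j.
Proof. by rewrite /upd => /negPf->. Qed.

(* Stack 0 is the oracle tape and stack 1 the input and output tape. *)
Inductive prog :=
| Skip
| Push of nat & bool
| Pop of nat
| Seq of prog & prog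
| If of nat & (symbol -> bool) & prog & prog
| While of nat & (symbol -> bool) & prog
| Query.

Declare Scope prog_scope.
Bind Scope prog_scope with prog.
Infix ";;" := Seq (at level 61, right associativity) : prog_scope.
Local Open Scope prog_scope.

Inductive exec (O : word -> word) : prog -> (nat -> word) -> (nat -> word) -> Prop :=
| ExecSkip s : exec O Skip s s
| ExecPush s i b : exec O (Push i b) s (upd s i (b :: s i))
| ExecPop s i b w : s i = b :: w -> exec O (Pop i) s (upd s i w)
| ExecSeq p q s1 s2 s3 :
    exec O p s1 s2 -> exec O q s2 s3 -> exec O (p ;; q) s1 s3
| ExecIfT i (P : symbol -> bool) p q s1 s2 :
    P (ohead (s1 i)) -> exec O p s1 s2 -> exec O (If i P p q) s1 s2
| ExecIfF i (P : symbol -> bool) p q s1 s2 :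
    ~~ P (ohead (s1 i)) -> exec O q s1 s2 -> exec O (If i P p q) s1 s2
| ExecWhileF i (P : symbol -> bool) p s : ~~ P (ohead (s i)) -> exec O (While i P p) s s
| ExecWhileT i (P : symbol -> bool) p s1 s2 s3 :
    P (ohead (s1 i)) -> exec O p s1 s2 -> exec O (While i P p) s2 s3 ->
    exec O (While i P p) s1 s3
| ExecQuery s : exec O Query s (upd s 0 (O (s 0))).

Fixpoint stack_bound (p : prog) : nat :=
  match p with
  | Skip | Query => 0
  | Push i _ | Pop i => i
  | p ;; q => maxn (stack_bound p) (stack_bound q)
  | If i _ p q => maxn i (maxn (stack_bound p) (stack_bound q))
  | While i _ p => maxn i (stack_bound p)
  end.

(** * Compilation to Turing machines *)

Variant instr :=
| Act of nat & (symbol -> symbol * move)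
| Branch of nat & (symbol -> bool) & nat
| Ask.

Fixpoint code_size (p : prog) : nat :=
  match p with
  | Skip => 0
  | Push _ _ => 2
  | Pop _ | Query => 1
  | p ;; q => code_size p + code_size q
  | If _ _ p q => code_size p + code_size q + 2
  | While _ _ p => code_size p + 2
  end.

(* [Branch i P l] jumps to the absolute address [l] unless [P] holds; [off] is
   the address of the compiled code.  Pushing takes two instructions because a
   machine step writes before it moves. *)
Fixpoint compile (p : prog) (off : nat) : seq instr :=
  match p with
  | Skip => [::]
  | Push i b => [:: Act i (fun s => (s, MoveLeft)); Act i (fun=> (Some b, Stay))]
  | Pop i => [:: Act i (fun s => (s, MoveRight))]
  | p ;; q => compile p off ++ compile q (off + code_size p)
  | If i P p q =>
      Branch i P (off + code_size p + 2) ::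
      compile p off.+1 ++
      Branch 0 xpred0 (off + code_size p + code_size q + 2) ::
      compile q (off + code_size p + 2)
  | While i P p =>
      Branch i P (off + code_size p + 2) ::
      compile p off.+1 ++ [:: Branch 0 xpred0 off]
  | Query => [:: Ask]
  end.

Lemma size_compile p off : size (compile p off) = code_size p.
Proof.
elim: p off => //= [p IHp q IHq|i P p IHp q IHq|i P p IHp] off.
- by rewrite size_cat IHp IHq.
- by rewrite size_cat /= IHp IHq addn2 addnS.
- by rewrite size_cat /= IHp addn1 addn2.
Qed.

Section Machine.
Variables (M : otm) (code : seq instr) (K : nat).

Definition mstate : finType := (state M + 'I_(size code).+1)%type.
Definition mtapes : finType := (tapes M + 'I_K.+1)%type.

(** Stack 1 is the input and output tape of [M] itself, so the code finds the output of [M] where it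
    expects its own input; all other stacks are fresh tapes. *)
Definition stack_tape (i : nat) : mtapes :=
  if i == 1 then inl (io_tape M) else inr (inord i).

(** The address [size code] is a legal state that carries no instruction: the machine halts
    there. *)
Definition goto (l : nat) : mstate := inr (inord l).

(** States of [M] never ask, which is faithful to [M] only if it is oracle-free. *)
Definition mquery (q : mstate) : option mstate :=
  match q with
  | inl _ => None
  | inr pc => if onth code pc is Some Ask then Some (goto pc.+1) else None
  end.

Definition mdelta (q : mstate) (s : {ffun mtapes -> symbol}) :
    option (mstate * {ffun mtapes -> symbol * move}) :=
  match q with
  | inl q =>
      if delta q [ffun i => s (inl i)] is Some (q', act) then
        Some (inl q', [ffun i => match i with
                                 | inl j => act j
                                 | inr _ => (s i, Stay)
                                 end])
      else Some (goto 0, [ffun i => (s i, Stay)])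
  | inr pc =>
      match onth code pc with
      | Some (Act i f) =>
          Some (goto pc.+1,
                [ffun t => if t == stack_tape i then f (s t) else (s t, Stay)])
      | Some (Branch i P l) =>
          Some (goto (if P (s (stack_tape i)) then pc.+1 else l),
                [ffun t => (s t, Stay)])
      | _ => None
      end
  end.

(* Runs [M] first, then [code] on the output of [M]. *)
Definition machine : otm :=
  @OTM mstate mtapes (inl (start M)) (inl (io_tape M)) (inr ord0) mquery mdelta.

Variable O : word -> word.

Definition reach (c c' : config machine) : Prop :=
  exists k, iter k (obind (step O)) (Some c) = Some c'.

Lemma reach_refl c : reach c c.
Proof. by exists 0. Qed.

Lemma reach_trans c1 c2 c3 : reach c1 c2 -> reach c2 c3 -> reach c1 c3.
Proof.
by move=> [k1 e1] [k2 e2]; exists (k2 + k1)%N; rewrite iterD e1 e2.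
Qed.

Lemma reach_step c c' : step O c = Some c' -> reach c c'.
Proof. by move=> e; exists 1. Qed.

(** Only the word between the head and the first blank counts. A pop leaves its symbol to the left
    of the head, where a later push overwrites it. *)
Definition agree (ts : {ffun mtapes -> tape}) (s : nat -> word) : Prop :=
  forall i, (i <= K)%N -> word_of_tape (ts (stack_tape i)) = s i.

Lemma scan_word t : scan t = ohead (word_of_tape t).
Proof. by case: t => l [|[b|] r]. Qed.

Lemma word_idle t : word_of_tape (write (scan t) t) = word_of_tape t.
Proof. by case: t => l [|[b|] r]. Qed.

Lemma agree_idle (ts : {ffun mtapes -> tape}) s : agree ts s ->
  agree [ffun i => write (scan (ts i)) (ts i)] s.
Proof. by move=> a i iK; rewrite ffunE word_idle a. Qed.

Lemma stack_tape_inj i j : (i <= K)%N -> (j <= K)%N ->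
  (stack_tape i == stack_tape j) = (i == j).
Proof.
move=> iK jK; rewrite /stack_tape.
case: (eqVneq i 1%N) => [ei|i1]; case: (eqVneq j 1%N) => [ej|j1];
  rewrite ?ei ?ej ?eqxx //.
- by rewrite [RHS]eq_sym (negPf j1).
- by rewrite (negPf i1).
- apply/eqP/eqP => [|->//].
  by move/(congr1 (fun t => if t is inr y then val y else 0%N)); rewrite /= !inordK.
Qed.

Lemma goto_onth pc : (pc < size code)%N ->
  onth code (inord pc : 'I_(size code).+1) = onth code pc.
Proof. by move=> h; rewrite inordK // ltnS ltnW. Qed.

Lemma onth_size (pc : nat) x : onth code pc = Some x -> (pc < size code)%N.
Proof. by move=> e; rewrite -onthTE e. Qed.

Lemma reach_act pc i f ts : onth code pc = Some (Act i f) ->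
  reach (goto pc, ts)
    (goto pc.+1, [ffun t => if t == stack_tape i
                            then Defs.shift (f (scan (ts t))).2 (write (f (scan (ts t))).1 (ts t))
                            else write (scan (ts t)) (ts t)]).
Proof.
move=> e; apply: reach_step; rewrite /step /= goto_onth ?(onth_size e) // e /=.
congr (Some (goto _, _)); first by rewrite inordK // ltnS ltnW // (onth_size e).
by apply/ffunP => t; rewrite !ffunE; case: ifP.
Qed.

Lemma reach_branch pc i P l ts : onth code pc = Some (Branch i P l) ->
  reach (goto pc, ts)
    (goto (if P (scan (ts (stack_tape i))) then pc.+1 else l),
     [ffun t => write (scan (ts t)) (ts t)]).
Proof.
move=> e; apply: reach_step; rewrite /step /= goto_onth ?(onth_size e) // e /=.
rewrite ffunE inordK ?ltnS ?(ltnW (onth_size e)) //.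
by congr (Some (_, _)); apply/ffunP => t; rewrite !ffunE.
Qed.

Lemma reach_ask pc ts : onth code pc = Some Ask ->
  reach (goto pc, ts)
    (goto pc.+1, [ffun t => if t == inr ord0
                            then tape_of_word (O (word_of_tape (ts t)))
                            else ts t]).
Proof.
move=> e; apply: reach_step; rewrite /step /= goto_onth ?(onth_size e) // e /=.
by rewrite inordK ?ltnS ?(ltnW (onth_size e)).
Qed.

Lemma word_of_tape_of_word w : word_of_tape (tape_of_word w) = w.
Proof. by elim: w => //= b w; rewrite /word_of_tape /= => ->. Qed.

Lemma onth_mid (T : Type) (s t : seq T) x : onth (s ++ x :: t) (size s) = Some x.
Proof. by elim: s. Qed.

(** The induction is on the execution, not on the program: after one round of a loop there remains
    an execution of the same loop, so its induction hypothesis applies with the same [pre] and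
    [post]. These two lists pin down the absolute addresses of the jumps. *)
Lemma compile_correct p s s' : exec O p s s' -> (stack_bound p <= K)%N ->
  forall pre post ts, code = pre ++ compile p (size pre) ++ post -> agree ts s ->
  exists2 ts', reach (goto (size pre), ts) (goto (size pre + code_size p), ts')
             & agree ts' s'.
Proof.
elim=> {p s s'}
  [s|s i b|s i b w si|p q s1 s2 s3 _ IHp _ IHq|i P p q s1 s2 Ps _ IHp
  |i P p q s1 s2 Ps _ IHq|i P p s Ps|i P p s1 s2 s3 Ps _ IHp _ IHw|s]
  /= bK pre post ts ec ag.
- by exists ts; rewrite ?addn0 //; exact: reach_refl.
- have e1 : onth code (size pre) = Some (Act i (fun s => (s, MoveLeft))).
    by rewrite ec onth_mid.
  have e2 : onth code (size pre).+1 = Some (Act i (fun=> (Some b, Stay))).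
    by rewrite ec -cat_rcons -(size_rcons pre (Act i (fun s => (s, MoveLeft))))
         onth_mid.
  eexists; first by rewrite addn2;
    exact: reach_trans (reach_act _ e1) (reach_act _ e2).
  move=> j jK; rewrite !ffunE stack_tape_inj // /upd.
  case: eqP => [->|_]; last by rewrite !word_idle ag.
  have := ag i bK; case: (ts _) => l r /= <-.
  by case: r => [|[c|] r].
- have e1 : onth code (size pre) = Some (Act i (fun s => (s, MoveRight))).
    by rewrite ec onth_mid.
  eexists; first by rewrite addn1; exact: reach_act e1.
  move=> j jK; rewrite !ffunE stack_tape_inj // /upd.
  case: eqP => [->|_]; last by rewrite word_idle ag.
  have := ag i bK; rewrite si; case: (ts _) => l [|[c|] r] //=.
  by rewrite /word_of_tape /= => -[_ ->].
- move: bK; rewrite geq_max => /andP[pK qK].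
  have [|ts1 r1 a1] := IHp pK pre (compile q (size pre + code_size p) ++ post) ts _ ag.
    by rewrite ec -!catA.
  have [|ts2 r2 a2] := IHq qK (pre ++ compile p (size pre)) post ts1 _ a1.
    by rewrite ec size_cat size_compile -!catA.
  exists ts2 => //; move: r2; rewrite size_cat size_compile -addnA.
  exact: reach_trans.
- move: bK; rewrite !geq_max => /and3P[iK pK qK].
  set l1 := (X in Branch i P X) in ec; set l2 := (X in Branch 0 xpred0 X) in ec.
  have e1 : onth code (size pre) = Some (Branch i P l1) by rewrite ec onth_mid.
  have r1 := reach_branch ts e1.
  rewrite scan_word ag // Ps in r1.
  have [|ts2 r2 a2] := IHp pK (rcons pre (Branch i P l1))
    (Branch 0 xpred0 l2 :: compile q (size pre + code_size p + 2) ++ post)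
    _ _ (agree_idle ag); first by rewrite ec size_rcons cat_rcons /= -catA.
  have e2 : onth code (size (rcons pre (Branch i P l1)) + code_size p) =
      Some (Branch 0 xpred0 l2).
    rewrite -(size_compile p (size pre).+1) -size_cat.
    suff -> : code = (rcons pre (Branch i P l1) ++ compile p (size pre).+1) ++
      Branch 0 xpred0 l2 :: compile q (size pre + code_size p + 2) ++ post by rewrite onth_mid.
    by rewrite ec -catA cat_rcons /= -!catA.
  have r3 := reach_branch ts2 e2.
  exists [ffun t => write (scan (ts2 t)) (ts2 t)]; last exact: agree_idle.
  apply: reach_trans r1 _; rewrite -(size_rcons pre (Branch i P l1)).
  apply: reach_trans r2 _.
  by rewrite !addnA; exact: r3.
- move: bK; rewrite !geq_max => /and3P[iK pK qK].
  set l1 := (X in Branch i P X) in ec; set l2 := (X in Branch 0 xpred0 X) in ec.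
  have e1 : onth code (size pre) = Some (Branch i P l1) by rewrite ec onth_mid.
  have r1 := reach_branch ts e1.
  rewrite scan_word ag // (negPf Ps) in r1.
  set pre' := pre ++ Branch i P l1 :: compile p (size pre).+1 ++ [:: Branch 0 xpred0 l2].
  have spre' : size pre' = l1.
    by rewrite size_cat /= size_cat /= size_compile /l1 addn1 addn2 !addnS.
  have [|ts2 r2 a2] := IHq qK pre' post _ _ (agree_idle ag).
    by rewrite spre' ec /pre' -!catA /= -!catA.
  exists ts2 => //; apply: reach_trans r1 _.
  by move: r2; rewrite spre' /l1 !addnA (addnAC _ 2%N).
- move: bK; rewrite !geq_max => /andP[iK pK].
  set l1 := (X in Branch i P X) in ec.
  have e1 : onth code (size pre) = Some (Branch i P l1) by rewrite ec onth_mid.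
  have r1 := reach_branch ts e1.
  rewrite scan_word ag // (negPf Ps) in r1.
  by rewrite addnA; eexists; [exact: r1|exact: agree_idle].
- move: (bK); rewrite !geq_max => /andP[iK pK].
  set l1 := (X in Branch i P X) in ec.
  have e1 : onth code (size pre) = Some (Branch i P l1) by rewrite ec onth_mid.
  have r1 := reach_branch ts e1.
  rewrite scan_word ag // Ps in r1.
  have [|ts2 r2 a2] := IHp pK (rcons pre (Branch i P l1))
    (Branch 0 xpred0 (size pre) :: post) _ _ (agree_idle ag).
    by rewrite ec size_rcons cat_rcons /= -catA.
  have e2 : onth code (size (rcons pre (Branch i P l1)) + code_size p) =
      Some (Branch 0 xpred0 (size pre)).
    rewrite -(size_compile p (size pre).+1) -size_cat.
    suff -> : code = (rcons pre (Branch i P l1) ++ compile p (size pre).+1) ++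
      Branch 0 xpred0 (size pre) :: post by rewrite onth_mid.
    by rewrite ec -catA cat_rcons /= -!catA.
  have r3 := reach_branch ts2 e2.
  have [ts4 r4 a4] := IHw bK pre post _ ec (agree_idle a2).
  exists ts4 => //.
  apply: reach_trans r1 _; rewrite -(size_rcons pre (Branch i P l1)).
  exact: reach_trans r2 (reach_trans r3 r4).
- have e1 : onth code (size pre) = Some Ask by rewrite ec onth_mid.
  eexists; first by rewrite addn1; exact: reach_ask e1.
  move=> j jK; rewrite !ffunE.
  have -> : inr ord0 = stack_tape 0.
    by rewrite /stack_tape /=; congr inr; apply/val_inj; rewrite /= inordK.
  rewrite stack_tape_inj // /upd.
  by case: eqP => [->|_]; rewrite ?word_of_tape_of_word ag.
Qed.

(** An oracle-free run does not depend on the oracle, so a run with [O'] can be repeated under [O].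
    Meanwhile the fresh tapes are idle, and their words stay empty. *)
Lemma reach_prelude O' k w c : oracle_free M ->
  iter k (obind (step O')) (Some (init M w)) = Some c ->
  exists2 ts : {ffun mtapes -> tape}, reach (init machine w) (inl c.1, ts)
    & (forall i, ts (inl i) = c.2 i) /\ forall i, word_of_tape (ts (inr i)) = [::].
Proof.
move=> free; elim: k c => [|k IHk] c /=.
  move=> [<-]; eexists; first exact: reach_refl.
  by split=> i; rewrite /= !ffunE.
case e: (iter _ _ _) => [c1|] //=.
rewrite /step free; case ed: (delta _ _) => [[q' act]|] // [<-].
have [ts r [ts1 ts2]] := IHk c1 e.
eexists; last split.
- apply: reach_trans r (reach_step _); rewrite /step /=.
  have -> : [ffun i => [ffun i => scan (ts i)] (inl i)] = [ffun i => scan (c1.2 i)].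
    by apply/ffunP => i; rewrite !ffunE ts1.
  by rewrite ed; reflexivity.
- by move=> i; rewrite !ffunE /= ts1.
- by move=> i; rewrite !ffunE /= word_idle ts2.
Qed.

End Machine.

Definition io_state (w : word) : nat -> word := upd (fun=> [::]) 1 w.

Lemma machine_outputs (M : otm) (p : prog) : oracle_free M ->
  exists M' : otm, forall O' O w w1 s', outputs M O' w w1 ->
    exec O p (io_state w1) s' -> outputs M' O w (s' 1%N).
Proof.
(* The successor makes stack 1, which carries the output, one of the stacks even if [p] does not
   mention it. *)
move=> free; pose K := (stack_bound p).+1; pose code := compile p 0.
exists (machine M code K) => O' O w w1 s' [k [c [ek hk ow]]] ex.
have [ts r0 [ts1 ts2]] := reach_prelude code K O free ek.
have r1 : reach O ((inl c.1, ts) : config (machine M code K))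
    (goto M code 0, [ffun t => write (scan (ts t)) (ts t)]).
  apply: reach_step; rewrite /step /=.
  have -> : [ffun i => [ffun i => scan (ts i)] (inl i)] = [ffun i => scan (c.2 i)].
    by apply/ffunP => i; rewrite !ffunE ts1.
  move: hk; rewrite /step free; case: (delta _ _) => [[]|] // _.
  by congr (Some (_, _)); apply/ffunP => i; rewrite !ffunE.
have ag : agree ts (io_state w1).
  move=> i iK; rewrite /stack_tape /io_state /upd; case: eqP => [_|_].
    by rewrite ts1.
  by rewrite ts2.
have [|ts' r2 ag'] := compile_correct (code := code) ex (leqnSn _) (pre := [::])
  (post := [::]) _ (agree_idle ag); first by rewrite cats0.
have [k' e'] := reach_trans r0 (reach_trans r1 r2).
exists k', (goto M code (code_size p), ts'); split => //.
  have esz : size code = code_size p by rewrite size_compile.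
  have ed : onth code (code_size p) = None by apply: onth_default; rewrite esz.
  by rewrite /step /= inordK ?esz // ed.
by have := ag' 1%N isT.
Qed.

(** * Functions of natural numbers computed by programs *)

(* Register [i] is the stack [i.+2]; it holds a number in unary. *)
Definition regs (o w : word) (r : nat -> nat) (i : nat) : word :=
  match i with
  | 0 => o
  | 1 => w
  | i'.+2 => nat_code (r i')
  end.

Lemma upd_upd (T : Type) (f : nat -> T) i x y : upd (upd f i x) i y = upd f i y.
Proof. by apply/funext => j; rewrite /upd; case: eqP. Qed.

Lemma upd_id (T : Type) (f : nat -> T) i : upd f i (f i) = f.
Proof. by apply/funext => j; rewrite /upd; case: eqP => [->|]. Qed.

Lemma upd_regs o w r i n :
  upd (regs o w r) i.+2 (nat_code n) = regs o w (upd r i n).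
Proof. by apply/funext => -[|[|j]] //; rewrite /upd /= !eqSS; case: eqP. Qed.

Lemma upd_regs0 o o' w r : upd (regs o w r) 0 o' = regs o' w r.
Proof. by apply/funext => -[|[|j]]. Qed.

Lemma upd_regs1 o w w' r : upd (regs o w r) 1 w' = regs o w' r.
Proof. by apply/funext => -[|[|j]]. Qed.

Definition is_one : symbol -> bool := fun s => s == Some true.

(** * Loops that consume a stack *)

Section Macros.
Local Open Scope nat_scope.
Variable O : word -> word.
Implicit Types (s : nat -> word) (r : nat -> nat).

Lemma exec_inc i o w r :
  exec O (Push i.+2 true) (regs o w r) (regs o w (upd r i (r i).+1)).
Proof. by rewrite -upd_regs; exact: ExecPush. Qed.

Definition drain c p := While c is_one (Pop c ;; p).

(** [F k] is the state with [k] ones left on top of stack [c]. What lies below them only must not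
    begin with [true], so the rule covers an empty rest as well as a rest behind a separator
    [false]. *)
Lemma exec_drain c p n (F : nat -> nat -> word) :
  (forall k, (k <= n)%N -> ohead (F k c) = if k is 0 then ohead (F 0 c) else Some true) ->
  ohead (F 0 c) != Some true ->
  (forall k, (k < n)%N -> exec O (Pop c ;; p) (F k.+1) (F k)) ->
  exec O (drain c p) (F n) (F 0).
Proof.
elim: n => [|n IHn] h0 h1 h2; first by apply: ExecWhileF.
apply: ExecWhileT; first by rewrite h0.
  exact: h2.
by apply: IHn => // k kn; [apply: h0|apply: h2]; exact: leqW.
Qed.

Definition move i j := drain i.+2 (Push j.+2 true).

Lemma exec_move i j o w r : i != j ->
  exec O (move i j) (regs o w r) (regs o w (upd (upd r j (r j + r i)) i 0)).
Proof.
move=> ij.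
pose F k := regs o w (upd (upd r j (r j + (r i - k))) i k).
have -> : regs o w r = F (r i).
  by rewrite /F subnn addn0 !upd_id.
have -> : regs o w (upd (upd r j (r j + r i)) i 0) = F 0 by rewrite /F subn0.
apply: exec_drain => [[|k] _||k kn] //; rewrite ?/F /= ?updE //.
apply: ExecSeq; first by apply: ExecPop; rewrite /= updE; reflexivity.
rewrite upd_regs.
have -> : upd (upd r j (r j + (r i - k))) i k =
    upd (upd (upd (upd r j (r j + (r i - k.+1))) i k.+1) i k) j
     (upd (upd (upd r j (r j + (r i - k.+1))) i k.+1) i k j).+1.
  apply/funext => x; rewrite /upd !eqxx [j == i]eq_sym (negPf ij).
  case: eqP => [->|_]; first by rewrite (negPf ij).
  by case: eqP => // _; rewrite -addnS subnSK.
exact: exec_inc.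
Qed.

Definition clear c := While c (fun x => x != None) (Pop c).

Lemma exec_clear c s : exec O (clear c) s (upd s c [::]).
Proof.
move: {2}(s c) (erefl (s c)) => u; elim: u s => [|b u IHu] s e.
  by rewrite -e upd_id; apply: ExecWhileF; rewrite e.
apply: ExecWhileT; first by rewrite e.
  by apply: ExecPop e.
by rewrite -(upd_upd s c u); apply: IHu; rewrite updE.
Qed.

Lemma exec_clear_reg i o w r :
  exec O (clear i.+2) (regs o w r) (regs o w (upd r i 0)).
Proof. by rewrite -upd_regs; exact: exec_clear. Qed.

Definition skip_ones c := drain c Skip.

Lemma exec_skip_ones c s n w : s c = nat_code n ++ false :: w ->
  exec O (skip_ones c) s (upd s c (false :: w)).
Proof.
move=> e; pose F k := upd s c (nat_code k ++ false :: w).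
have -> : s = F n by rewrite /F -e upd_id.
rewrite {2}/F upd_upd -/(F 0).
apply: exec_drain => [[|k] _||k kn] //; rewrite /F ?updE //.
apply: ExecSeq (ExecSkip _ _).
rewrite -(upd_upd s c (nat_code k.+1 ++ false :: w) (nat_code k ++ false :: w)).
by apply: ExecPop; rewrite updE.
Qed.

Definition read_ones c i := drain c (Push i true).

Lemma exec_read_ones c i s n w : i != c -> s c = nat_code n ++ false :: w ->
  exec O (read_ones c i) s (upd (upd s c (false :: w)) i (nat_code n ++ s i)).
Proof.
move=> ic e.
pose F k := upd (upd s c (nat_code k ++ false :: w)) i (nat_code (n - k) ++ s i).
have -> : upd (upd s c (false :: w)) i (nat_code n ++ s i) = F 0 by rewrite /F subn0.
rewrite [X in exec _ _ X](_ : s = F n); last by rewrite /F subnn -e /= upd_id upd_id.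
have ci : c != i by rewrite eq_sym.
apply: exec_drain => [[|k] _||k kn] //; rewrite /F ?(updN _ _ ci) ?updE //.
apply: ExecSeq; first by apply: ExecPop; rewrite (updN _ _ ci) updE; reflexivity.
set s1 := upd _ c _.
have -> : upd (upd s c (nat_code k ++ false :: w)) i (nat_code (n - k) ++ s i) =
    upd s1 i (true :: s1 i).
  rewrite /s1; apply/funext => x; rewrite /upd !eqxx (negPf ic).
  by case: (x == i); rewrite -?(subnSK kn) //; case: eqP.
exact: ExecPush.
Qed.

Definition skip_rat c := Pop c ;; skip_ones c ;; Pop c ;; skip_ones c ;; Pop c.

Lemma exec_pop c s b w : exec O (Pop c) (upd s c (b :: w)) (upd s c w).
Proof. by rewrite -(upd_upd s c (b :: w) w); apply: ExecPop; rewrite updE. Qed.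

Lemma exec_skip_rat c s q w : s c = rat_code q ++ w ->
  exec O (skip_rat c) s (upd s c w).
Proof.
rewrite /rat_code /= -!catA /= -!catA /= => e.
apply: ExecSeq (ExecPop _ e) _.
apply: ExecSeq; first by apply: exec_skip_ones; rewrite updE.
rewrite upd_upd; apply: ExecSeq (exec_pop _ _ _ _) _.
apply: ExecSeq; first by apply: exec_skip_ones; rewrite updE.
by rewrite upd_upd; exact: exec_pop.
Qed.

End Macros.

Ltac upd_cases := apply/funext => x; rewrite /upd;
  repeat (case: eqP => ?; try (exfalso; lia)); subst; lia.

(** * Closure under composition, primitive recursion and minimization *)

Section Computable.
Local Open Scope nat_scope.
Variables (m : nat) (D : (nat -> 'rV[rat]_m) -> Prop).
Implicit Types (phi : nat -> 'rV[rat]_m) (s : seq nat) (r : nat -> nat).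

Definition below d r := forall i, d <= i -> r i = 0.

Definition fits d k (l : seq nat) := (size l == k) && all (ltn^~ d) l.

Lemma belowS d r x : below d r -> below d.+1 (upd r d x).
Proof. by move=> b i di; rewrite updN ?b ?gtn_eqF // ltnW. Qed.

Lemma fitsS d k l : fits d k l -> fits d.+1 k l.
Proof.
rewrite /fits => /andP[-> /allP h]; apply/allP => i /h /= id; exact: ltnW.
Qed.

Lemma map_upd d k l r x : fits d k l -> map (upd r d x) l = map r l.
Proof.
move=> /andP[_ /allP h]; apply/eq_in_map => i /h /= id.
by rewrite updN // ltn_eqF.
Qed.

Lemma size_fits d k l r : fits d k l -> size (map r l) = k.
Proof. by rewrite size_map => /andP[/eqP]. Qed.

(* The function of [k] arguments [f], which may consult the oracle [phi], is
   computed from the registers [l], all below [d], into the register [d]; the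
   registers from [d] on serve as work space and are zero at the beginning and,
   except for [d], at the end. *)
Definition cfun k (f : (nat -> 'rV[rat]_m) -> seq nat -> nat) :=
  forall d l, fits d k l -> exists p, forall phi w r, D phi -> below d r ->
    exec (seq_oracle phi) p (regs [::] w r)
      (regs [::] w (upd r d (f phi (map r l)))).

Lemma cfun_ext k f g :
  (forall phi s, D phi -> size s = k -> f phi s = g phi s) ->
  cfun k f -> cfun k g.
Proof.
move=> fg cf d l fl; have [p hp] := cf d l fl; exists p => phi w r Dphi br.
by rewrite -fg //; [exact: hp|exact: size_fits fl].
Qed.

Lemma cfun_const k c : cfun k (fun _ _ => c).
Proof.
move=> d l fl; elim: c => [|c [p hp]].
  exists Skip => phi w r _ br; rewrite -(br d) // upd_id; exact: ExecSkip.
exists (p ;; Push d.+2 true) => phi w r Dphi br.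
apply: ExecSeq (hp _ _ _ Dphi br) _.
by have := exec_inc (seq_oracle phi) d [::] w (upd r d c); rewrite updE upd_upd.
Qed.

Lemma cfun_succ k f : cfun k f -> cfun k (fun phi s => (f phi s).+1).
Proof.
move=> cf d l fl; have [p hp] := cf d l fl.
exists (p ;; Push d.+2 true) => phi w r Dphi br.
apply: ExecSeq (hp _ _ _ Dphi br) _.
have := exec_inc (seq_oracle phi) d [::] w (upd r d (f phi (map r l))).
by rewrite updE upd_upd.
Qed.

(** Reading a register destroys it. So its content is copied twice, into [d] and into [d.+1], and
    the second copy is moved back. *)
Lemma cfun_var k i : i < k -> cfun k (fun _ s => nth 0 s i).
Proof.
move=> ik d l fl; pose j := nth 0 l i.
have jd : j < d.
  by move: fl => /andP[/eqP sl /allP /(_ j)]; apply; rewrite mem_nth // sl.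
pose p := drain j.+2 (Push d.+2 true ;; Push d.+3 true).
exists (p ;; move d.+1 j) => phi w r _ br.
rewrite (nth_map 0); last by move: fl => /andP[/eqP ->].
rewrite -/j.
have jd0 : (j == d) = false by rewrite ltn_eqF.
have jd1 : (j == d.+1) = false by rewrite ltn_eqF // ltnW.
have d01 : (d == d.+1) = false by lia.
pose F k := regs [::] w (upd (upd (upd r d (r j - k)) d.+1 (r j - k)) j k).
have -> : regs [::] w r = F (r j).
  rewrite /F subnn; congr regs; apply/funext => x; rewrite /upd.
  by case: eqP => [->//|_]; case: eqP => [->|_]; [|case: eqP => [->|//]]; rewrite br.
apply: (@ExecSeq _ _ _ _ (F 0)).
  apply: exec_drain => [[|k'] _||k' kk] //; rewrite ?/F /= ?updE //.
  apply: ExecSeq; first by apply: ExecPop; rewrite /= updE; reflexivity.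
  rewrite upd_regs upd_upd; apply: ExecSeq (exec_inc _ _ _ _ _) _.
  set r1 := upd _ d _.
  have -> : upd (upd (upd r d (r j - k')) d.+1 (r j - k')) j k' =
      upd r1 d.+1 (r1 d.+1).+1.
    by rewrite /r1; upd_cases.
  exact: exec_inc.
rewrite [X in exec _ _ _ X](_ : _ = regs [::] w
    (upd (upd (upd (upd (upd r d (r j - 0)) d.+1 (r j - 0)) j 0) j (0 + r j)) d.+1 0)).
  have := exec_move (seq_oracle phi) [::] w
   (upd (upd (upd r d (r j - 0)) d.+1 (r j - 0)) j 0) (i := d.+1) (j := j).
  rewrite updE [upd _ j 0 d.+1]updN 1?eq_sym ?jd1 // updE subn0.
  by rewrite /F !subn0; apply.
have b1 := br d.+1 (leqnSn d).
by congr regs; upd_cases.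
Qed.

Lemma cfun_comp1 k h f : cfun 1 h -> cfun k f ->
  cfun k (fun phi s => h phi [:: f phi s]).
Proof.
move=> ch cf d l fl; have [p hp] := cf d l fl.
have [|q hq] := ch d.+1 [:: d]; first by rewrite /fits /= ltnS leqnn.
exists (p ;; q ;; clear d.+2 ;; move d.+1 d) => phi w r Dphi br.
apply: ExecSeq (hp _ _ _ Dphi br) _.
apply: ExecSeq (hq _ _ _ Dphi (belowS _ br)) _.
rewrite /= updE; apply: ExecSeq (exec_clear_reg _ _ _ _ _) _.
set v := h _ _; set r1 := upd _ d 0.
have d01 : (d == d.+1) = false by lia.
have -> : upd r d v = upd (upd r1 d (r1 d + r1 d.+1)) d.+1 0.
  by have b1 := br d.+1 (leqnSn d); rewrite /r1; upd_cases.
by apply: exec_move; rewrite eq_sym d01.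
Qed.

Lemma cfun_comp2 k h f g : cfun 2 h -> cfun k f -> cfun k g ->
  cfun k (fun phi s => h phi [:: f phi s; g phi s]).
Proof.
move=> ch cf cg d l fl; have [p hp] := cf d l fl.
have [p' hp'] := cg d.+1 l (fitsS fl).
have [|q hq] := ch d.+2 [:: d; d.+1]; first by rewrite /fits /= !ltnS leqnSn leqnn.
exists (p ;; p' ;; q ;; clear d.+2 ;; clear d.+3 ;; move d.+2 d) => phi w r Dphi br.
apply: ExecSeq (hp _ _ _ Dphi br) _.
apply: ExecSeq (hp' _ _ _ Dphi (belowS _ br)) _.
apply: ExecSeq (hq _ _ _ Dphi (belowS _ (belowS _ br))) _.
have d01 : (d == d.+1) = false by lia.
have d02 : (d == d.+2) = false by lia.
have d12 : (d.+1 == d.+2) = false by lia.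
rewrite (map_upd _ _ fl) /= updE (updN _ _ (negbT d01)) updE.
apply: ExecSeq (exec_clear_reg _ _ _ _ _) _.
apply: ExecSeq (exec_clear_reg _ _ _ _ _) _.
set v := h _ _; set r1 := upd _ d.+1 0.
have -> : upd r d v = upd (upd r1 d (r1 d + r1 d.+2)) d.+2 0.
  have b1 := br d.+1 (leqnSn d).
  have b2 := br d.+2 (ltnW (ltnW (leqnn _))).
  by rewrite /r1; upd_cases.
by apply: exec_move; rewrite eq_sym d02.
Qed.

(** Register [d] counts the remaining rounds down, [d.+1] counts the index up, and [d.+2] holds the
    accumulated value, whose successor is computed in [d.+3]. *)
Lemma cfun_rec k n f g : cfun k n -> cfun k f -> cfun k.+2 g ->
  cfun k (fun phi s =>
    nat_rect (fun=> nat) (f phi s) (fun i a => g phi [:: i, a & s]) (n phi s)).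
Proof.
move=> cn cf cg d l fl; have [p hp] := cn d l fl.
have fl1 := fitsS fl; have fl2 := fitsS fl1; have fl3 := fitsS fl2.
have [p' hp'] := cf d.+2 l fl2.
have [|q hq] := cg d.+3 [:: d.+1, d.+2 & l].
  by move: fl3 => /andP[sl al]; rewrite /fits /= !eqSS sl al !ltnS leqnSn leqnn.
pose body := q ;; clear d.+4 ;; move d.+3 d.+2 ;; Push d.+3 true.
exists (p ;; p' ;; drain d.+2 body ;; clear d.+3 ;; move d.+2 d) => phi w r Dphi br.
set R := nat_rect _ _ _.
have d01 : (d == d.+1) = false by lia.
have d02 : (d == d.+2) = false by lia.
have d12 : (d.+1 == d.+2) = false by lia.
have d03 : (d == d.+3) = false by lia.
have d13 : (d.+1 == d.+3) = false by lia.
have d23 : (d.+2 == d.+3) = false by lia.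
apply: ExecSeq (hp _ _ _ Dphi br) _.
set N := n phi _.
have -> : upd r d N = upd (upd r d N) d.+1 0.
  by rewrite -[in RHS](belowS N br (leqnn d.+1)) upd_id.
apply: ExecSeq (hp' _ _ _ Dphi (belowS _ (belowS _ br))) _.
rewrite (map_upd _ _ fl1) (map_upd _ _ fl).
pose F j := regs [::] w (upd (upd (upd r d j) d.+1 (N - j)) d.+2 (R (N - j))).
have -> : upd (upd (upd r d N) d.+1 0) d.+2 (f phi (map r l)) =
  upd (upd (upd r d N) d.+1 (N - N)) d.+2 (R (N - N)) by rewrite subnn.
rewrite -/(F N).
apply: (@ExecSeq _ _ _ _ (F 0)).
  have Fd j : F j d.+2 = nat_code j by rewrite /F /= /upd d02 d01 eqxx.
  apply: exec_drain => [[|j] _||j jN]; rewrite ?Fd //.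
  rewrite /F; apply: ExecSeq.
    by apply: ExecPop; exact: (Fd j.+1).
  rewrite upd_regs; set i := N - j.+1.
  have -> : upd (upd (upd (upd r d j.+1) d.+1 i) d.+2 (R i)) d j =
     upd (upd (upd r d j) d.+1 i) d.+2 (R i).
    by upd_cases.
  apply: ExecSeq (hq _ _ _ Dphi (belowS _ (belowS _ (belowS _ br)))) _.
  rewrite /= (map_upd _ _ fl2) (map_upd _ _ fl1) (map_upd _ _ fl).
  rewrite updE (updN _ _ (negbT d12)) updE.
  apply: ExecSeq (exec_clear_reg _ _ _ _ _) _.
  apply: ExecSeq.
    by apply: exec_move; rewrite eq_sym d23.
  set r1 := upd _ d.+3 0.
  have -> : upd (upd (upd r d j) d.+1 (N - j)) d.+2 (R (N - j)) =
      upd r1 d.+1 (r1 d.+1).+1.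
    rewrite -(subnSK jN) -/i.
    have b3 := br d.+3 (ltnW (ltnW (ltnW (leqnn _)))).
    have Ri : R i.+1 = g phi [:: i, R i & map r l] by [].
    by rewrite /r1 Ri; upd_cases.
  exact: exec_inc.
rewrite /F !subn0.
apply: ExecSeq (exec_clear_reg _ _ _ _ _) _.
set r1 := upd _ d.+1 0.
have -> : upd r d (R N) = upd (upd r1 d (r1 d + r1 d.+2)) d.+2 0.
  have b1 := br d.+1 (leqnSn d).
  have b2 := br d.+2 (ltnW (ltnW (leqnn _))).
  by rewrite /r1; upd_cases.
by apply: exec_move; rewrite eq_sym d02.
Qed.

(** Register [d] holds the candidate and [d.+1] the value of the test, which is 0 when the loop
    stops, so nothing is left to be cleared. A zero of the test is required for oracles in [D] only;
    this is what allows a machine to search forever outside its domain. *)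
Lemma cfun_mu k f t : cfun k.+1 t ->
  (forall phi s, D phi -> size s = k -> t phi (f phi s :: s) = 0) ->
  (forall phi s i, D phi -> size s = k -> i < f phi s -> t phi (i :: s) != 0) ->
  cfun k f.
Proof.
move=> ct t0 tn d l fl.
have [|q hq] := ct d.+1 (d :: l).
  by move: (fitsS fl) => /andP[sl al]; rewrite /fits /= eqSS sl al ltnS leqnn.
pose loop := While d.+3 is_one (clear d.+3 ;; Push d.+2 true ;; q).
exists (q ;; loop) => phi w r Dphi br.
set s := map r l; have ss : size s = k by apply: size_fits fl.
have d01 : (d == d.+1) = false by lia.
pose G i := upd (upd r d i) d.+1 (t phi (i :: s)).
have hq' i : exec (seq_oracle phi) q (regs [::] w (upd r d i)) (regs [::] w (G i)).
  have := hq phi w (upd r d i) Dphi (belowS _ br).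
  by rewrite /= updE (map_upd _ _ fl).
have G0 : regs [::] w (G (f phi s)) = regs [::] w (upd r d (f phi s)).
  rewrite /G t0 //; congr regs.
  by rewrite -[in LHS](belowS (f phi s) br (leqnn d.+1)) upd_id.
apply: (@ExecSeq _ _ _ _ (regs [::] w (G 0))).
  by have := hq' 0; rewrite -{1}(br d) // upd_id.
rewrite -G0.
have loopF i : i <= f phi s -> exec (seq_oracle phi) loop
    (regs [::] w (G (f phi s - i))) (regs [::] w (G (f phi s))).
  elim: i => [_|i IHi le].
    rewrite subn0; apply: ExecWhileF => /=.
    by rewrite /G updE t0.
  set j := f phi s - i.+1.
  have lj : j < f phi s by rewrite /j subnS prednK ?subn_gt0 // leq_subr.
  apply: ExecWhileT (IHi (ltnW le)).
    by rewrite /= /G updE; have := tn _ _ _ Dphi ss lj; case: (t _ _).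
  apply: ExecSeq (exec_clear_reg _ _ _ _ _) _.
  have -> : upd (G j) d.+1 0 = upd r d j.
    by rewrite /G upd_upd -[in LHS](belowS j br (leqnn d.+1)) upd_id.
  apply: ExecSeq (exec_inc _ _ _ _ _) _.
  by rewrite updE upd_upd /j subnSK.
by have := loopF _ (leqnn _); rewrite subnn.
Qed.

(** ** Arithmetic *)

Lemma cfun_add k f g : cfun k f -> cfun k g ->
  cfun k (fun phi s => f phi s + g phi s).
Proof.
apply: (@cfun_comp2 k (fun _ s => nth 0 s 0 + nth 0 s 1)).
apply: (cfun_ext _ (cfun_rec (@cfun_var 2 1 isT) (@cfun_var 2 0 isT)
  (cfun_succ (@cfun_var 4 1 isT)))) => phi s _ _ /=.
by elim: (nth 0 s 1) => [|x /= ->]; rewrite ?addn0 ?addnS.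
Qed.

Lemma cfun_mul k f g : cfun k f -> cfun k g ->
  cfun k (fun phi s => f phi s * g phi s).
Proof.
apply: (@cfun_comp2 k (fun _ s => nth 0 s 0 * nth 0 s 1)).
apply: (cfun_ext _ (cfun_rec (@cfun_var 2 1 isT) (@cfun_const 2 0)
  (cfun_add (@cfun_var 4 2 isT) (@cfun_var 4 1 isT)))) => phi s _ _ /=.
by elim: (nth 0 s 1) => [|x /= ->]; rewrite ?muln0 ?mulnS.
Qed.

(** The index of the last round of a recursion is the predecessor of its length. *)
Lemma cfun_pred k f : cfun k f -> cfun k (fun phi s => (f phi s).-1).
Proof.
apply: (@cfun_comp1 k (fun _ s => (nth 0 s 0).-1)).
apply: (cfun_ext _ (cfun_rec (@cfun_var 1 0 isT) (@cfun_const 1 0)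
  (@cfun_var 3 0 isT))) => phi s _ _ /=.
by case: (nth 0 s 0).
Qed.

Lemma cfun_sub k f g : cfun k f -> cfun k g ->
  cfun k (fun phi s => f phi s - g phi s).
Proof.
apply: (@cfun_comp2 k (fun _ s => nth 0 s 0 - nth 0 s 1)).
apply: (cfun_ext _ (cfun_rec (@cfun_var 2 1 isT) (@cfun_var 2 0 isT)
  (cfun_pred (@cfun_var 4 1 isT)))) => phi s _ _ /=.
by elim: (nth 0 s 1) => [|x /= ->]; rewrite ?subn0 ?subnS.
Qed.

Lemma cfun_exp k c f : cfun k f -> cfun k (fun phi s => c ^ f phi s).
Proof.
apply: (@cfun_comp1 k (fun _ s => c ^ nth 0 s 0)).
apply: (cfun_ext _ (cfun_rec (@cfun_var 1 0 isT) (@cfun_const 1 1)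
  (cfun_mul (@cfun_const 3 c) (@cfun_var 3 1 isT)))) => phi s _ _ /=.
by elim: (nth 0 s 0) => [|x /= ->]; rewrite ?expnS.
Qed.

Lemma cfun_max k f g : cfun k f -> cfun k g ->
  cfun k (fun phi s => maxn (f phi s) (g phi s)).
Proof.
move=> cf cg; apply: (cfun_ext _ (cfun_add cf (cfun_sub cg cf))) => phi s _ _.
by rewrite maxnE.
Qed.

Lemma cfun_lt k f g : cfun k f -> cfun k g ->
  cfun k (fun phi s => f phi s < g phi s : nat).
Proof.
move=> cf cg.
apply: (cfun_ext _ (cfun_sub (@cfun_const k 1) (cfun_sub (cfun_succ cf) cg))).
by move=> phi s _ _ /=; case: ltnP; lia.
Qed.

(** The quotient counts the positive multiples of [b] up to [a]. In this form division is a
    primitive recursion that needs only comparisons. *)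
Lemma divn_sum a b : 0 < b -> a %/ b = \sum_(i < a) (a >= i.+1 * b).
Proof.
move=> b0; rewrite -(big_mkord xpredT (fun i => nat_of_bool (i.+1 * b <= a))).
rewrite (eq_bigr (fun i => nat_of_bool (i < a %/ b))) => [|i _]; last first.
  by rewrite leq_divRL.
rewrite (big_cat_nat (n := a %/ b)) ?leq_div //= [X in _ + X]big1_seq ?addn0.
  rewrite (eq_big_nat _ _ (F2 := fun=> 1)) => [|i /= ->//].
  by rewrite sum_nat_const_nat subn0 muln1.
by move=> i; rewrite mem_index_iota => /and3P[_ h _]; rewrite ltnNge h.
Qed.

Lemma cfun_div k f g : cfun k f -> cfun k g ->
  (forall phi s, D phi -> size s = k -> 0 < g phi s) ->
  cfun k (fun phi s => f phi s %/ g phi s).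
Proof.
move=> cf cg g0.
pose h := fun (phi : nat -> 'rV[rat]_m) s => nat_rect (fun=> nat) 0
  (fun i a => a + ((i.+1 * nth 0 s 1) < (nth 0 s 0).+1)) (nth 0 s 0).
have ch : cfun 2 h.
  exact: (cfun_rec (@cfun_var 2 0 isT) (@cfun_const 2 0)
    (cfun_add (@cfun_var 4 1 isT)
      (cfun_lt (cfun_mul (cfun_succ (@cfun_var 4 0 isT)) (@cfun_var 4 3 isT))
        (cfun_succ (@cfun_var 4 2 isT))))).
apply: (cfun_ext _ (cfun_comp2 ch cf cg)) => phi s Dphi ss.
rewrite divn_sum ?g0 // /h /=; set a := f _ _; set b := g _ _.
have aux x : nat_rect (fun=> nat) 0 (fun i c => c + (i.+1 * b < a.+1)) x =
    \sum_(i < x) (i.+1 * b <= a).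
  by elim: x => [|x /= ->]; rewrite ?big_ord0 ?big_ord_recr.
exact: aux.
Qed.

Lemma cfun_sum k n (f : nat -> (nat -> 'rV[rat]_m) -> seq nat -> nat) :
  (forall i, i < n -> cfun k (f i)) ->
  cfun k (fun phi s => \sum_(i < n) f i phi s).
Proof.
elim: n => [|n IHn] cf.
  by apply: (cfun_ext _ (@cfun_const k 0)) => phi s _ _; rewrite big_ord0.
apply: (cfun_ext _ (cfun_add (IHn (fun i h => cf i (ltnW h))) (cf n (leqnn _)))).
by move=> phi s _ _; rewrite big_ord_recr.
Qed.

End Computable.

(** ** Reading and writing rational points *)

Section Parsing.
Local Open Scope nat_scope.
Variable O : word -> word.
Implicit Types (s : nat -> word) (q : rat).

Definition read_rat c i :=
  If c is_one (Push i true) Skip ;; Pop c ;;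
  read_ones c i.+1 ;; Pop c ;; read_ones c i.+2 ;; Pop c.

Lemma exec_read_rat c i s q w : c < i -> s c = rat_code q ++ w ->
  s i = [::] -> s i.+1 = [::] -> s i.+2 = [::] ->
  exec O (read_rat c i) s
    (upd (upd (upd (upd s c w) i (nat_code (q < 0)%R))
         i.+1 (nat_code `|numq q|)) i.+2 (nat_code `|denq q|)).
Proof.
rewrite /rat_code /= -!catA /= -!catA /= => ci e i0 i1 i2.
have ic : i != c by lia.
have i1c : i.+1 != c by lia.
have i2c : i.+2 != c by lia.
apply: (@ExecSeq _ _ _ _ (upd s i (nat_code (q < 0)%R))).
  case: ltP => q0; last first.
    apply: ExecIfF; first by rewrite e /= /is_one; case: ltP q0.
    by rewrite -[nat_code _]/([::] : word) -i0 upd_id; exact: ExecSkip.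
  apply: ExecIfT; first by rewrite e /= q0.
  by rewrite -[nat_code _]/(true :: [::]) -i0; exact: ExecPush.
apply: ExecSeq; first by apply: ExecPop; rewrite updN ?e // eq_sym.
apply: ExecSeq; first by apply: exec_read_ones => //; rewrite updE; reflexivity.
apply: ExecSeq.
  by apply: ExecPop; rewrite updN ?updE 1?eq_sym //; reflexivity.
apply: ExecSeq; first by apply: exec_read_ones => //; rewrite updE; reflexivity.
set s1 := upd _ i.+2 _.
have -> : upd (upd (upd (upd s c w) i (nat_code (q < 0)%R)) i.+1
   (nat_code `|numq q|)) i.+2 (nat_code `|denq q|) = upd s1 c w.
  apply/funext => x; rewrite /s1 /upd.
  by repeat (case: eqP => ?; try (exfalso; lia)); subst; rewrite ?i1 ?i2 ?cats0.
by apply: ExecPop; rewrite /s1 /upd; repeat (case: eqP => ?; try (exfalso; lia)).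
Qed.

Definition codes (qs : seq rat) : word := flatten (map rat_code qs).

Definition skip_rats c n := iter n (Seq (skip_rat c)) Skip.

Lemma exec_skip_rats c s qs n : n <= size qs -> s c = codes qs ->
  exec O (skip_rats c n) s (upd s c (codes (drop n qs))).
Proof.
elim: n qs s => [|n IHn] [|q qs] s //= nq e.
- by rewrite -e upd_id; exact: ExecSkip.
- by rewrite -e upd_id; exact: ExecSkip.
- apply: ExecSeq (exec_skip_rat _ e) _.
  by have := IHn qs (upd s c (codes qs)) nq; rewrite upd_upd updE; apply.
Qed.

(** A stack grows at its front, so the code is written from its end: the denominator, then the
    numerator, then the sign. *)
Definition push_rat d := 
  Push 1 false ;; drain d.+4 (Push 1 true) ;; Push 1 false ;;
  drain d.+3 (Push 1 true) ;; If d.+2 is_one (Pop d.+2 ;; Push 1 true) (Push 1 false).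

Lemma exec_push1 o w r b : exec O (Push 1 b) (regs o w r) (regs o (b :: w) r).
Proof. by rewrite -(upd_regs1 o w (b :: w)); exact: ExecPush. Qed.

Lemma exec_push0 o w r b : exec O (Push 0 b) (regs o w r) (regs (b :: o) w r).
Proof. by rewrite -(upd_regs0 o (b :: o)); exact: ExecPush. Qed.

Lemma exec_drain1 o w r d :
  exec O (drain d.+2 (Push 1 true)) (regs o w r)
         (regs o (nat_code (r d) ++ w) (upd r d 0)).
Proof.
pose F k := regs o (nat_code (r d - k) ++ w) (upd r d k).
have -> : regs o w r = F (r d) by rewrite /F subnn upd_id.
rewrite -{2}(subn0 (r d)) -/(F 0).
apply: exec_drain => [[|k] _||k kd] //; rewrite ?/F /= ?updE //.
apply: ExecSeq; first by apply: ExecPop; rewrite /= updE; reflexivity.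
by rewrite upd_regs upd_upd -(subnSK kd); exact: exec_push1.
Qed.

(** Defined for any three numbers, but the code of a rational number only for a fraction in lowest
    terms. *)
Definition triple_code (a b c : nat) : word :=
  (a != 0) :: nat_code b ++ false :: nat_code c ++ [:: false].

Lemma triple_code_rat q :
  triple_code (q < 0)%R `|numq q| `|denq q| = rat_code q.
Proof. by rewrite /triple_code /rat_code; case: (q < 0)%R. Qed.

Lemma exec_push_rat o w r d : r d <= 1 ->
  exec O (push_rat d) (regs o w r)
    (regs o (triple_code (r d) (r d.+1) (r d.+2) ++ w)
       (upd (upd (upd r d.+2 0) d.+1 0) d 0)).
Proof.
move=> r1; rewrite /triple_code /= -catA /= -catA /=.
apply: ExecSeq (exec_push1 _ _ _ _) _.
apply: ExecSeq (exec_drain1 _ _ _ _) _.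
apply: ExecSeq (exec_push1 _ _ _ _) _.
apply: ExecSeq (exec_drain1 _ _ _ _) _.
rewrite updN ?(eqn_leq, ltnn) ?andbF //.
set r' := upd _ d.+1 0.
have -> : r d = r' d by rewrite /r' /upd; repeat (case: eqP => ?; try (exfalso; lia)).
have : r' d <= 1 by rewrite /r' /upd; repeat (case: eqP => ?; try (exfalso; lia)).
case e : (r' d) => [|[|//]] _.
  apply: ExecIfF; first by rewrite /= e.
  by rewrite -e upd_id e; exact: exec_push1.
apply: ExecIfT; first by rewrite /= e.
apply: ExecSeq; first by apply: ExecPop; rewrite /= e; reflexivity.
by rewrite (upd_regs _ _ _ _ 0); exact: exec_push1.
Qed.

End Parsing.

(** * Oracle queries and the output of rational points *)

Section Oracle.
Local Open Scope nat_scope.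
Variables (m : nat) (D : (nat -> 'rV[rat]_m) -> Prop).
Implicit Types (phi : nat -> 'rV[rat]_m) (s : seq nat) (r : nat -> nat).

Lemma ratpoint_codeE (q : 'rV[rat]_m) :
  ratpoint_code q = codes [seq q ord0 i | i <- enum 'I_m].
Proof. by rewrite /codes -map_comp. Qed.

Definition field (t : nat) (q : rat) : nat :=
  match t with 0 => (q < 0)%R | 1 => `|numq q| | _ => `|denq q| end.

(** Each field of each coordinate is obtained by a query of its own, so that no oracle answer has to
    be kept between two evaluations. *)
Lemma cfun_field k t (i : 'I_m) f : t < 3 -> cfun D k f ->
  cfun D k (fun phi s => field t (phi (f phi s) ord0 i)).
Proof.
move=> t3.
apply: (@cfun_comp1 _ _ k (fun phi s => field t (phi (nth 0 s 0) ord0 i))) => d l fl.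
have [p hp] := @cfun_var _ D 1 0 isT d l fl.
pose select := match t with
               | 0 => clear d.+3 ;; clear d.+4
               | 1 => clear d.+2 ;; clear d.+4 ;; move d.+1 d
               | _ => clear d.+2 ;; clear d.+3 ;; move d.+2 d
               end.
exists (p ;; drain d.+2 (Push 0 true) ;; Query ;; skip_rats 0 i ;;
        read_rat 0 d.+2 ;; clear 0 ;; select) => phi w r Dphi br.
apply: ExecSeq (hp _ _ _ Dphi br) _.
set j := nth 0 (map r l) 0; set q := phi j ord0 i.
have b1 := br d.+1 (leqnSn d).
have b2 := br d.+2 (ltnW (ltnW (leqnn _))).
apply: (@ExecSeq _ _ _ _ (regs (nat_code j) w r)).
  pose F k := regs (nat_code (j - k)) w (upd r d k).
  have -> : regs [::] w (upd r d j) = F j by rewrite /F subnn.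
  have -> : regs (nat_code j) w r = F 0 by rewrite /F subn0 -(br d) // upd_id.
  apply: exec_drain => [[|x] _||x xj] //; rewrite ?/F /= ?updE //.
  apply: ExecSeq; first by apply: ExecPop; rewrite /= updE; reflexivity.
  rewrite upd_regs upd_upd -(subnSK xj).
  exact: exec_push0.
apply: ExecSeq (ExecQuery _ _) _.
rewrite /seq_oracle /= size_nseq upd_regs0 ratpoint_codeE.
set qs := map _ _.
have sqs : size qs = m by rewrite size_map size_enum_ord.
apply: ExecSeq.
  by apply: (@exec_skip_rats _ 0 _ qs) => //; rewrite sqs ltnW.
rewrite upd_regs0 (drop_nth (0%R : rat)) ?sqs // [nth _ _ _](_ : _ = q); last first.
  by rewrite (nth_map i) ?size_enum_ord // nth_ord_enum.
apply: ExecSeq.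
  apply: (@exec_read_rat _ 0 d.+2 _ q (codes (drop i.+1 qs))) => //=.
  - by rewrite br.
  - by rewrite b1.
  - by rewrite b2.
rewrite upd_regs0 !upd_regs.
apply: ExecSeq (exec_clear _ _ _) _; rewrite upd_regs0.
set r1 := upd _ d.+2 _.
have r1E : r1 = upd (upd (upd r d (field 0 q)) d.+1 (field 1 q)) d.+2 (field 2 q) by [].
rewrite {}/select; case: t t3 => [|[|[|//]]] _.
- apply: ExecSeq (exec_clear_reg _ _ _ _ _) _.
  rewrite [upd r d _](_ : _ = upd (upd r1 d.+1 0) d.+2 0); first exact: exec_clear_reg.
  by rewrite r1E; clear -br b1 b2; upd_cases.
- apply: ExecSeq (exec_clear_reg _ _ _ _ _) _.
  apply: ExecSeq (exec_clear_reg _ _ _ _ _) _.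
  set r2 := upd _ d.+2 0.
  rewrite [upd r d _](_ : _ = upd (upd r2 d (r2 d + r2 d.+1)) d.+1 0).
    by apply: exec_move; lia.
  by rewrite /r2 r1E; clear -br b1 b2; upd_cases.
- apply: ExecSeq (exec_clear_reg _ _ _ _ _) _.
  apply: ExecSeq (exec_clear_reg _ _ _ _ _) _.
  set r2 := upd _ d.+1 0.
  rewrite [upd r d _](_ : _ = upd (upd r2 d (r2 d + r2 d.+2)) d.+2 0).
    by apply: exec_move; lia.
  by rewrite /r2 r1E; clear -br b1 b2; upd_cases.
Qed.

(** The last triple has to be pushed first, hence the induction splits off the index [n] and not the
    index 0. All registers are restored after each triple, so the same [d] and [l] serve for all of
    them. *)
Lemma push_rats k n (sg nu de : nat -> (nat -> 'rV[rat]_m) -> seq nat -> nat) d l :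
  (forall i, i < n -> [/\ cfun D k (sg i), cfun D k (nu i) & cfun D k (de i)]) ->
  fits d k l ->
  exists p, forall phi w r, D phi -> below d r ->
    (forall i, i < n -> sg i phi (map r l) <= 1) ->
    exec (seq_oracle phi) p (regs [::] w r)
      (regs [::] (flatten [seq triple_code (sg i phi (map r l)) (nu i phi (map r l))
                             (de i phi (map r l)) | i <- iota 0 n] ++ w) r).
Proof.
move=> cf fl; elim: n cf => [|n IHn] cf.
  by exists Skip => phi w r _ _ _; exact: ExecSkip.
have [p hp] := IHn (fun i h => cf i (ltnW h)).
have [cs cn cd] := cf n (leqnn _).
have [p1 hp1] := cs d l fl.
have [p2 hp2] := cn d.+1 l (fitsS fl).
have [p3 hp3] := cd d.+2 l (fitsS (fitsS fl)).
exists (p1 ;; p2 ;; p3 ;; push_rat d ;; p) => phi w r Dphi br le1.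
apply: ExecSeq (hp1 _ _ _ Dphi br) _.
apply: ExecSeq (hp2 _ _ _ Dphi (belowS _ br)) _.
rewrite (map_upd _ _ fl).
apply: ExecSeq (hp3 _ _ _ Dphi (belowS _ (belowS _ br))) _.
rewrite (map_upd _ _ (fitsS fl)) (map_upd _ _ fl).
set s := map r l; set r1 := upd _ d.+2 _.
have e0 : r1 d = sg n phi s.
  by rewrite /r1 /upd; repeat (case: eqP => ?; try (exfalso; lia)).
have e1 : r1 d.+1 = nu n phi s.
  by rewrite /r1 /upd; repeat (case: eqP => ?; try (exfalso; lia)).
have e2 : r1 d.+2 = de n phi s by rewrite /r1 updE.
apply: ExecSeq.
  by apply: exec_push_rat; rewrite e0; exact: le1.
rewrite [upd (upd (upd r1 _ _) _ _) _ _](_ : _ = r); last first.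
  have b0 := br d (leqnn d).
  have b1 := br d.+1 (leqnSn d).
  have b2 := br d.+2 (ltnW (ltnW (leqnn _))).
  by rewrite /r1; upd_cases.
have := hp phi (triple_code (r1 d) (r1 d.+1) (r1 d.+2) ++ w) r Dphi br
  (fun i h => le1 i (ltnW h)).
have -> : iota 0 n.+1 = iota 0 n ++ [:: n] by rewrite -[in LHS]addn1 iotaD.
rewrite e0 e1 e2 map_cat flatten_cat catA.
by rewrite [flatten [seq _ | i <- [:: n]]](cats0 (triple_code _ _ _)).
Qed.

Lemma oracle_machine n (sg nu de : nat -> (nat -> 'rV[rat]_m) -> seq nat -> nat) :
  (forall i, i < n -> [/\ cfun D 1 (sg i), cfun D 1 (nu i) & cfun D 1 (de i)]) ->
  exists M : otm, forall phi j, D phi ->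
    (forall i, i < n -> sg i phi [:: j] <= 1) ->
    outputs M (seq_oracle phi) (nat_code j)
      (flatten [seq triple_code (sg i phi [:: j]) (nu i phi [:: j])
                      (de i phi [:: j]) | i <- iota 0 n]).
Proof.
move=> cf; have [p hp] := @push_rats 1 n sg nu de 1 [:: 0] cf isT.
(* This machine halts at once, so the code starts on the original input, which it moves to register
   0. *)
pose M0 := @OTM unit unit tt tt tt (fun=> None) (fun _ _ => None).
have [M hM] := @machine_outputs M0 (drain 1 (Push 2 true) ;; p) (fun=> erefl).
exists M => phi j Dphi le1.
pose r := upd (fun=> 0) 0 j.
have := hM (fun=> [::]) (seq_oracle phi) (nat_code j) (nat_code j)
  (regs [::] (flatten [seq triple_code (sg i phi [:: j]) (nu i phi [:: j])
                      (de i phi [:: j]) | i <- iota 0 n]) r).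
apply.
  exists 0, (init M0 (nat_code j)); split => //.
  by rewrite /= ffunE /= word_of_tape_of_word.
apply: (@ExecSeq _ _ _ _ (regs [::] [::] r)).
  pose F k := regs [::] (nat_code k) (upd (fun=> 0) 0 (j - k)).
  have -> : io_state (nat_code j) = F j.
    apply/funext => -[|[|x]] //.
    by rewrite /io_state /F /= subnn /upd /=; case: x.
  have -> : regs [::] [::] r = F 0 by rewrite /F subn0.
  apply: exec_drain => [[|k] _||k kj] //.
  apply: ExecSeq; first by apply: ExecPop; reflexivity.
  rewrite upd_regs1 /F -(subnSK kj).
  have := exec_inc (seq_oracle phi) 0 [::] (nat_code k) (upd (fun=> 0) 0 (j - k.+1)).
  by rewrite updE upd_upd.
have := hp phi [::] r Dphi _ le1; rewrite cats0; apply.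
by move=> i i0; rewrite /r updN // -lt0n.
Qed.

(** Meant for constant controls obtained from a computable real: [M] prints an approximation of the
    real, and the code rearranges its three fields into a rational point. *)
Lemma postprocess_machine (M : otm) n
    (sg nu de : nat -> (nat -> 'rV[rat]_m) -> seq nat -> nat) :
  oracle_free M ->
  (forall i, i < n -> [/\ cfun D 3 (sg i), cfun D 3 (nu i) & cfun D 3 (de i)]) ->
  exists M' : otm, forall phi O' w q, D phi ->
    outputs M O' w (rat_code q) ->
    let s := [:: field 0 q; field 1 q; field 2 q] in
    (forall i, i < n -> sg i phi s <= 1) ->
    outputs M' (seq_oracle phi) w
      (flatten [seq triple_code (sg i phi s) (nu i phi s) (de i phi s) | i <- iota 0 n]).
Proof.
move=> free cf; have [p hp] := @push_rats 3 n sg nu de 3 [:: 0; 1; 2] cf isT.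
have [M' hM] := @machine_outputs M (read_rat 1 2 ;; p) free.
exists M' => phi O' w q Dphi out s le1.
pose r := upd (upd (upd (fun=> 0) 0 (field 0 q)) 1 (field 1 q)) 2 (field 2 q).
have := hM O' (seq_oracle phi) w (rat_code q)
  (regs [::] (flatten [seq triple_code (sg i phi s) (nu i phi s)
                      (de i phi s) | i <- iota 0 n]) r) out.
apply.
apply: (@ExecSeq _ _ _ _ (regs [::] [::] r)).
  have -> : regs [::] [::] r = upd (upd (upd (upd (io_state (rat_code q)) 1 [::])
      2 (nat_code (field 0 q))) 3 (nat_code (field 1 q))) 4 (nat_code (field 2 q)).
    by apply/funext => -[|[|[|[|[|x]]]]].
  by apply: exec_read_rat => //; rewrite /io_state updE cats0.
have := hp phi [::] r Dphi _ le1; rewrite cats0; apply.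
by move=> [|[|[|i]]].
Qed.

End Oracle.

(** * Euclidean norm *)

Section Euclid.
Variables (R : realType) (n : nat).
Implicit Types (u w z : 'rV[R]_n) (c : R).

Definition dot u w : R := \sum_(i < n) u ord0 i * w ord0 i.

Lemma dotC u w : dot u w = dot w u.
Proof. by apply: eq_bigr => i _; rewrite mulrC. Qed.

Lemma dotDl u w z : dot (u + w) z = dot u z + dot w z.
Proof. by rewrite /dot -big_split; apply: eq_bigr => i _; rewrite mxE mulrDl. Qed.

Lemma dotZl c u w : dot (c *: u) w = c * dot u w.
Proof. by rewrite /dot mulr_sumr; apply: eq_bigr => i _; rewrite mxE mulrA. Qed.

Lemma dotDr u w z : dot z (u + w) = dot z u + dot z w.
Proof. by rewrite dotC dotDl !(dotC z). Qed.

Lemma dotZr c u w : dot u (c *: w) = c * dot u w.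
Proof. by rewrite dotC dotZl dotC. Qed.

Lemma dot_ge0 u : 0 <= dot u u.
Proof. by apply: sumr_ge0 => i _; rewrite -expr2 sqr_ge0. Qed.

Lemma dot_coord u i : u ord0 i ^+ 2 <= dot u u.
Proof.
rewrite /dot (bigD1 i) //= expr2 lerDl.
by apply: sumr_ge0 => j _; rewrite -expr2 sqr_ge0.
Qed.

Lemma dot_eq0 u : (dot u u == 0) = (u == 0).
Proof.
apply/eqP/eqP => [u0|->]; last by rewrite -(scale0r 0) dotZl mul0r.
apply/rowP => i; rewrite mxE; apply/eqP; rewrite -sqrf_eq0 eq_le sqr_ge0.
by rewrite -u0 dot_coord.
Qed.

Lemma enormE u : enorm u = Num.sqrt (dot u u).
Proof. by rewrite /enorm /dot; under eq_bigr do rewrite expr2. Qed.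

Lemma enorm_ge0 u : 0 <= enorm u.
Proof. exact: sqrtr_ge0. Qed.

Lemma enorm_sqr u : enorm u ^+ 2 = dot u u.
Proof. by rewrite enormE sqr_sqrtr ?dot_ge0. Qed.

Lemma enorm_eq0 u : (enorm u == 0) = (u == 0).
Proof. by rewrite -sqrf_eq0 enorm_sqr dot_eq0. Qed.

Lemma enorm_gt0 u : (0 < enorm u) = (u != 0).
Proof. by rewrite lt_def enorm_ge0 andbT enorm_eq0. Qed.

Lemma enormZ c u : enorm (c *: u) = `|c| * enorm u.
Proof.
by rewrite !enormE dotZl dotZr mulrA -expr2 sqrtrM ?sqr_ge0 // sqrtr_sqr.
Qed.

Lemma enormN u : enorm (- u) = enorm u.
Proof. by rewrite -scaleN1r enormZ normrN1 mul1r. Qed.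

Lemma cauchy_schwarz u w : dot u w <= enorm u * enorm w.
Proof.
apply: le_trans (ler_norm _) _.
rewrite -ler_sqr ?nnegrE ?mulr_ge0 ?enorm_ge0 // real_normK ?num_real //.
rewrite exprMn !enorm_sqr; have [->|w0] := eqVneq w 0.
  by rewrite -(scale0r u) dotZr mul0r expr0n mulr_ge0 ?dot_ge0.
have ww : 0 < dot w w by rewrite lt_def dot_eq0 w0 dot_ge0.
(* Expanded, this square is |w|^2 times the difference of the two sides. *)
have := dot_ge0 (dot w w *: u + - dot u w *: w).
rewrite dotDl !dotDr !dotZl !dotZr (dotC w u).
move=> /le_trans h; rewrite -subr_ge0 -(pmulr_rge0 _ ww); apply: h.
by rewrite le_eqVlt; apply/orP; left; apply/eqP; ring.
Qed.

Lemma enormD u w : enorm (u + w) <= enorm u + enorm w.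
Proof.
rewrite -ler_sqr ?nnegrE ?addr_ge0 ?enorm_ge0 // sqrrD !enorm_sqr.
rewrite dotDl !dotDr (dotC w u); have := cauchy_schwarz u w; lra.
Qed.

Lemma enormB u w : `|enorm u - enorm w| <= enorm (u - w).
Proof.
have h1 := enormD (u - w) w; have h2 := enormD (w - u) u.
rewrite !subrK in h1 h2; rewrite -(enormN (w - u)) opprB in h2.
by rewrite ler_norml; lra.
Qed.

Lemma coord_le_enorm u i : `|u ord0 i| <= enorm u.
Proof.
rewrite -ler_sqr ?nnegrE ?enorm_ge0 ?normr_ge0 // real_normK ?num_real //.
by rewrite enorm_sqr dot_coord.
Qed.

Lemma enorm_le_sum u c : (forall i, `|u ord0 i| <= c) -> enorm u <= n%:R * c.
Proof.
move=> h; case: (posnP n) => [n0|n0].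
  have -> : u = 0 by apply/rowP => i; have := ltn_ord i; rewrite {2}n0.
  have /eqP -> : enorm (0 : 'rV[R]_n) == 0 by rewrite enorm_eq0.
  by rewrite [n in n%:R]n0 mul0r.
have c0 : 0 <= c by apply: le_trans (h (Ordinal n0)).
rewrite -ler_sqr ?nnegrE ?mulr_ge0 ?enorm_ge0 //.
rewrite enorm_sqr exprMn.
have : dot u u <= \sum_(i < n) c ^+ 2.
  apply: ler_sum => i _; rewrite -expr2 -(real_normK (num_real (u ord0 i))).
  by rewrite ler_sqr ?nnegrE.
move=> /le_trans; apply; rewrite sumr_const card_ord -[c ^+ 2 *+ n]mulr_natl.
by rewrite ler_wpM2r ?sqr_ge0 // expr2 -natrM ler_nat leq_pmulr.
Qed.

Lemma enorm_axis c (i : 'I_n) : enorm (c *: delta_mx ord0 i : 'rV[R]_n) = `|c|.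
Proof.
rewrite enormZ enormE /dot (bigD1 i) //= big1 ?mxE ?eqxx ?addr0.
  by rewrite mulr1 sqrtr1 mulr1.
by move=> j /negPf ji; rewrite !mxE eqxx ji mulr0.
Qed.

End Euclid.

(** * The computable controls *)

Lemma ratpoint_triples n (q : 'rV[rat]_n) (sg nu de : nat -> nat) :
  (forall i : 'I_n, [/\ sg i = field 0 (q ord0 i), nu i = field 1 (q ord0 i)
                      & de i = field 2 (q ord0 i)]) ->
  flatten [seq triple_code (sg i) (nu i) (de i) | i <- iota 0 n] = ratpoint_code q.
Proof.
move=> h; rewrite -val_enum_ord -map_comp /ratpoint_code; congr flatten.
by apply: eq_map => i /=; have [-> -> ->] := h i; exact: triple_code_rat.
Qed.

Lemma represents_dist (R : realType) m (z : 'rV[R]_m) phi N i :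
  represents phi z -> `|z ord0 i - ratr (phi N ord0 i)| <= 2 ^- N.
Proof.
move=> /(_ N); apply: le_trans.
by have := coord_le_enorm (z - map_mx ratr (phi N)) i; rewrite !mxE.
Qed.

Lemma computable_axis (R : realType) (b : R) n (i0 : 'I_n) (neg : bool) k
    (X : set 'rV[R]_k) : computable_real b ->
  computable_on X (fun=> ((-1) ^+ neg * b) *: delta_mx ord0 i0 : 'rV[R]_n).
Proof.
move=> [psi [[M [free hM]] rep]].
pose T := (nat -> 'rV[rat]_k) -> seq nat -> nat.
pose at0 (f g : T) i : T := if i == i0 :> nat then f else g.
(* The factor [0 < nth 0 s 1] takes care of an approximation equal to 0, whose code has the sign bit
   [false] after negation too. *)
pose sg := at0 (fun _ s => if neg then (1 - nth 0%N s 0) * (0 < nth 0%N s 1) else nth 0%N s 0)%N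
  (fun _ _ => 0%N).
pose nu := at0 (fun _ s => nth 0%N s 1) (fun _ _ => 0%N).
pose de := at0 (fun _ s => nth 0%N s 2) (fun _ _ => 1%N).
have cf i : (i < n)%N -> [/\ cfun (fun=> True) 3 (sg i), cfun (fun=> True) 3 (nu i)
    & cfun (fun=> True) 3 (de i)].
  move=> _; rewrite /sg /nu /de /at0; case: (i == i0 :> nat); split;
    try exact: cfun_const; try exact: cfun_var.
  case: neg {sg}; last exact: cfun_var.
  apply: cfun_mul; first by apply: cfun_sub; [exact: cfun_const|exact: cfun_var].
  by apply: cfun_lt; [exact: cfun_const|exact: cfun_var].
have [M' hM'] := postprocess_machine free cf.
exists M' => z _ phi _ j; pose q := psi j ord0 ord0.
pose q' : 'rV[rat]_n := ((-1) ^+ neg * q) *: delta_mx ord0 i0.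
have q'E (i : 'I_n) : q' ord0 i = if i == i0 then (-1) ^+ neg * q else 0.
  by rewrite !mxE eqxx /=; case: (i == i0); rewrite ?mulr1 ?mulr0.
exists q'; last first.
  rewrite /within_prec [X in enorm X](_ : _ =
    ((-1) ^+ neg * (b - ratr q)) *: delta_mx ord0 i0); last first.
    apply/rowP => i; rewrite /q' !mxE eqxx /=.
    case: (i == i0); rewrite ?mulr0 ?rmorph0 ?subrr //.
    by rewrite !mulr1 rmorphM rmorphXn rmorphN1 mulrBr.
  rewrite enorm_axis normrM normrX normrN1 expr1n mul1r.
  by have := represents_dist j ord0 rep; rewrite mxE.
have out : outputs M (fun=> [::]) (nat_code j) (rat_code q).
  have := hM j; rewrite /ratpoint_code.
  have -> : enum 'I_1 = [:: ord0].
    by apply: (inj_map val_inj); rewrite val_enum_ord.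
  by rewrite /= cats0.
pose s := [:: field 0 q; field 1 q; field 2 q].
rewrite -(@ratpoint_triples n q' (fun i => sg i phi s) (fun i => nu i phi s)
  (fun i => de i phi s)).
  apply: (hM' phi _ _ _ I out).
  move=> i _; rewrite /sg /at0; case: (i == i0 :> nat) => //.
  by rewrite /s /=; clear; case: neg; case: (q < 0)%R; lia.
move=> i; rewrite /sg /nu /de /at0 q'E; case: (i =P i0 :> nat) => [/val_inj ->|ne].
  rewrite eqxx /s /=; clear; case: neg; rewrite ?expr0 ?expr1 ?mul1r ?mulN1r //.
  rewrite numqN denqN abszN oppr_lt0; split => //.
  by rewrite lt0n absz_eq0 numq_eq0; case: ltgtP.
by rewrite ifN //; apply/eqP => e; apply: ne; rewrite e.
Qed.

(** * Pursuer's law: bound and Lipschitz estimates *)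

Section Pursuit.
Variables (R : realType) (n m K T0 : nat).
Implicit Types (s t : R) (p x y : 'rV[R]_n).

Definition time_left t : R := Num.max 0 (T0%:R - t).

Definition gauge s p : R := Num.max (s ^+ 2) (K%:R ^+ 2 * dot p p).

Definition pursuit t x y : 'rV[R]_n :=
  (m%:R * time_left t / gauge (time_left t) (y - x)) *: (y - x).

(** The square root of [gauge]. The machine computes [gauge], which needs no root; the estimates use
    [gsize], which is Lipschitz and positively homogeneous in the pair [(s, p)]. *)
Definition gsize s p : R := Num.max s (K%:R * enorm p).

Lemma time_left_ge0 t : 0 <= time_left t.
Proof. by rewrite /time_left le_max lexx. Qed.

Lemma gsize_sqr s p : 0 <= s -> gsize s p ^+ 2 = gauge s p.
Proof.
move=> s0; rewrite /gsize /gauge -enorm_sqr -exprMn.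
set k := _ * enorm p; have k0 : 0 <= k by rewrite mulr_ge0 ?enorm_ge0.
case: (leP s k) => h; first by rewrite max_r // ler_sqr ?nnegrE.
by rewrite max_l // ler_sqr ?nnegrE // ltW.
Qed.

Lemma gsize_ge0 s p : 0 <= gsize s p.
Proof. by rewrite le_max mulr_ge0 ?orbT ?enorm_ge0. Qed.

(** By this homogeneity s p / [gauge] s p is unchanged when [s] and [p] are both multiplied by 2^N,
    so it may be computed from integer approximations of the scaled data. *)
Lemma gsizeZ c s p : 0 <= c -> gsize (c * s) (c *: p) = c * gsize s p.
Proof.
by move=> c0; rewrite /gsize enormZ ger0_norm // mulrCA maxr_pMr.
Qed.

Lemma gsize_lip s s' p p' E : `|s - s'| <= E -> K%:R * enorm (p - p') <= E ->
  `|gsize s p - gsize s' p'| <= E.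
Proof.
move=> h1 h2; have : `|K%:R * enorm p - K%:R * enorm p'| <= E.
  rewrite -mulrBr normrM ger0_norm //; apply: le_trans h2.
  by rewrite ler_wpM2l // enormB.
move: h1; rewrite /gsize; set k := _ * enorm p; set k' := _ * enorm p'.
rewrite !ler_norml => /andP[? ?] /andP[? ?].
by case: (leP s k) => ?; case: (leP s' k') => ?; apply/andP; split; lra.
Qed.

(** The bound contains only [M'], which will be the approximate denominator: the machine knows it
    and can test whether it is large enough. The exact [M] disappears because [|c| <= M]. *)
Lemma quotient_lip (c c' M M' E : R) : 0 < M -> 0 < M' -> `|c| <= M ->
  `|c - c'| <= E -> `|M - M'| <= E -> `|c / M - c' / M'| <= 2 * E / M'.
Proof.
move=> M0 M'0 cM cc MM.
have -> : c / M - c' / M' = ((c - c') + c / M * (M' - M)) / M'.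
  by field; rewrite !gt_eqF.
rewrite normrM [`|M'^-1|]gtr0_norm ?invr_gt0 // ler_pM2r ?invr_gt0 //.
apply: le_trans (ler_normD _ _) _; rewrite mulr_natl mulr2n lerD //.
rewrite normrM distrC -[E]mul1r ler_pM //.
by rewrite normrM normfV (gtr0_norm M0) ler_pdivrMr // mul1r.
Qed.

(** The quotient is the product of s / M and p_i / M, where M is the size. Each factor has absolute
    value at most 1, the second one because K >= 1, and each has error at most 2 E / M'. *)
Lemma gauge_quotient_lip s s' p p' E i : (0 < K)%N -> 0 <= s -> 0 <= s' ->
  0 < gsize s p -> 0 < gsize s' p' ->
  `|s - s'| <= E -> K%:R * enorm (p - p') <= E ->
  `|s * p ord0 i / gauge s p - s' * p' ord0 i / gauge s' p'| <=
    4 * E / gsize s' p'.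
Proof.
move=> K0 s0 s'0 M0 M'0 es ep.
have MM := gsize_lip es ep.
have K1 : 1 <= K%:R :> R by rewrite ler1n.
have ep' : enorm (p - p') <= E by apply: le_trans ep; rewrite ler_peMl ?enorm_ge0.
have sM s1 p1 : 0 <= s1 -> `|s1| <= gsize s1 p1.
  by move=> ?; rewrite ger0_norm // le_max lexx.
have pM s1 p1 : `|p1 ord0 i| <= gsize s1 p1.
  rewrite le_max; apply/orP; right; apply: le_trans (coord_le_enorm p1 i) _.
  by rewrite ler_peMl ?enorm_ge0.
have epi : `|p ord0 i - p' ord0 i| <= E.
  by apply: le_trans ep'; have := coord_le_enorm (p - p') i; rewrite !mxE.
have h1 := quotient_lip M0 M'0 (sM _ _ s0) es MM.
have h2 := quotient_lip M0 M'0 (pM _ _) epi MM.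
rewrite -!gsize_sqr //; set M := gsize s p in M0 h1 h2 *.
set M' := gsize s' p' in M'0 h1 h2 *.
have -> : s * p ord0 i / M ^+ 2 - s' * p' ord0 i / M' ^+ 2 =
   (s / M - s' / M') * (p ord0 i / M) +
   (s' / M') * (p ord0 i / M - p' ord0 i / M').
  by field; rewrite !gt_eqF.
have -> : 4 * E / M' = 2 * E / M' + 2 * E / M' by field; rewrite gt_eqF.
apply: le_trans (ler_normD _ _) _; rewrite !normrM lerD //.
  rewrite -[leRHS]mulr1 ler_pM ?mulr_ge0 ?normr_ge0 //.
  by rewrite normfV (gtr0_norm M0) ler_pdivrMr // mul1r pM.
rewrite -[leRHS]mul1r ler_pM ?mulr_ge0 ?normr_ge0 //.
by rewrite normfV (gtr0_norm M'0) ler_pdivrMr // mul1r sM.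
Qed.

(** Both s and K |p| are at most the size M, so s K |p| <= M^2. *)
Lemma pursuit_bound t x y : (0 < K)%N -> x != y -> enorm (pursuit t x y) <= m%:R / K%:R.
Proof.
move=> K0 xy; rewrite /pursuit -gsize_sqr ?time_left_ge0 //.
set s := time_left t; set p := y - x; have s0 : 0 <= s by apply: time_left_ge0.
have K1 : 0 < K%:R :> R by rewrite ltr0n.
have p0 : 0 < enorm p by rewrite enorm_gt0 subr_eq0 eq_sym.
have M0 : 0 < gsize s p by rewrite lt_max [X in _ || X]mulr_gt0 ?orbT.
have sM : s <= gsize s p by rewrite le_max lexx.
have pM : K%:R * enorm p <= gsize s p by rewrite le_max lexx orbT.
rewrite enormZ ger0_norm; last first.
  by apply: divr_ge0; [exact: mulr_ge0|exact: sqr_ge0].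
set M := gsize s p in M0 sM pM *.
have -> : m%:R * s / M ^+ 2 * enorm p = m%:R * (s * enorm p) / M ^+ 2 by ring.
rewrite ler_pdivrMr ?exprn_gt0 // -mulrA ler_wpM2l // [_^-1 * _]mulrC ler_pdivlMr //.
by rewrite -mulrA [enorm p * _]mulrC expr2 ler_pM ?mulr_ge0 ?enorm_ge0.
Qed.

End Pursuit.

(** ** Integer approximations *)

Section Scaled.
Local Open Scope nat_scope.

(* The positive and the negative part of 2^N q, rounded towards zero. *)
Definition scaled_pos (q : rat) N := (1 - field 0 q) * (field 1 q * 2 ^ N %/ field 2 q).
Definition scaled_neg (q : rat) N := field 0 q * (field 1 q * 2 ^ N %/ field 2 q).

Variables (k0 : nat) (D : (nat -> 'rV[rat]_k0) -> Prop).

Lemma cfun_scaled_pos k f c : cfun D k f ->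
  cfun D k (fun phi s => scaled_pos (phi (f phi s) ord0 c) (f phi s)).
Proof.
move=> cf; rewrite /scaled_pos.
apply: cfun_mul; first by apply: cfun_sub; [exact: cfun_const|exact: (@cfun_field _ _ _ 0)].
apply: cfun_div; first by apply: cfun_mul; [exact: (@cfun_field _ _ _ 1)|exact: cfun_exp].
  exact: (@cfun_field _ _ _ 2).
by move=> phi s _ _ /=; rewrite absz_gt0 denq_neq0.
Qed.

Lemma cfun_scaled_neg k f c : cfun D k f ->
  cfun D k (fun phi s => scaled_neg (phi (f phi s) ord0 c) (f phi s)).
Proof.
move=> cf; rewrite /scaled_neg.
apply: cfun_mul; first exact: (@cfun_field _ _ _ 0).
apply: cfun_div; first by apply: cfun_mul; [exact: (@cfun_field _ _ _ 1)|exact: cfun_exp].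
  exact: (@cfun_field _ _ _ 2).
by move=> phi s _ _ /=; rewrite absz_gt0 denq_neq0.
Qed.

End Scaled.

Lemma floor_divn (R : realType) (a b : nat) : (0 < b)%N ->
  ((a %/ b)%N%:R <= a%:R / b%:R :> R) /\ (a%:R / b%:R < (a %/ b)%N%:R + 1 :> R).
Proof.
move=> b0; have b0' : 0 < b%:R :> R by rewrite ltr0n.
rewrite ler_pdivlMr // ltr_pdivrMr // -natrM ler_nat leq_trunc_div; split=> //.
by rewrite natr1 -natrM ltr_nat ltn_ceil.
Qed.

(** One unit of error comes from the approximation by [q], the other from rounding to an integer. *)
Lemma scaled_approx (R : realType) (z : R) (q : rat) N : `|z - ratr q| <= 2 ^- N ->
  `|2 ^+ N * z - ((scaled_pos q N)%:R - (scaled_neg q N)%:R)| <= 2.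
Proof.
move=> zq; have e0 : 0 < 2 ^+ N :> R by rewrite exprn_gt0.
have h1 : `|2 ^+ N * z - 2 ^+ N * ratr q| <= 1.
  by rewrite -mulrBr normrM gtr0_norm // mulrC -ler_pdivlMr // mul1r.
suff h2 : `|2 ^+ N * ratr q - ((scaled_pos q N)%:R - (scaled_neg q N)%:R)| <= 1 :> R.
  have -> : 2 ^+ N * z - ((scaled_pos q N)%:R - (scaled_neg q N)%:R) =
    (2 ^+ N * z - 2 ^+ N * ratr q) +
    (2 ^+ N * ratr q - ((scaled_pos q N)%:R - (scaled_neg q N)%:R)) by ring.
  by apply: le_trans (ler_normD _ _) _; rewrite (natrD _ 1 1) lerD.
rewrite /scaled_pos /scaled_neg /field.
have d0 : (0 < `|denq q|)%N by rewrite absz_gt0 denq_neq0.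
have [] := @floor_divn R (`|numq q| * 2 ^ N)%N _ d0.
set A := (_ %/ _)%N; rewrite natrM natrX.
have -> : ratr q = (if q < 0 then -1 else 1) * (`|numq q|%N%:R / `|denq q|%N%:R) :> R.
  rewrite /ratr -[denq q in LHS]gez0_abs ?denq_ge0 // -pmulrn mulrA; congr (_ / _).
  case: ltP => q0.
    by rewrite mulN1r -[LHS]opprK -mulrNz -ltz0_abs ?numq_lt0 // -pmulrn.
  by rewrite mul1r -[in LHS](gez0_abs (_ : 0 <= numq q)) ?numq_ge0 // -pmulrn.
set g := _ / _; set f := _ / _ => h2 h3.
have fg : g = 2 ^+ N * f by rewrite /f /g; ring.
case: ltP => _ /=; rewrite ?(mul0n, mul1n, subn0, subnn, mul0r, mul1r, mulN1r) ler_norml.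
  by apply/andP; split; lra.
by apply/andP; split; lra.
Qed.

(* Numerator and denominator are coprime because the numerator is odd. *)
Lemma field_odd_dyadic (neg : bool) (A J : nat) (q : rat) :
  q = (-1) ^+ neg * (A.*2.+1)%:R / 2 ^+ J ->
  [/\ field 0 q = neg, field 1 q = A.*2.+1 & field 2 q = (2 ^ J)%N].
Proof.
move=> qE; pose a : int := (-1) ^+ neg * (A.*2.+1)%:Z; pose d : int := (2 ^ J)%N%:Z.
have qE' : q = a%:~R / d%:~R.
  by rewrite qE /a /d rmorphM rmorphXn rmorphN1 /= -!pmulrn natrX.
have absa : `|a|%N = A.*2.+1 by rewrite /a abszMsign.
have cop : coprime `|a| `|d|.
  by rewrite absa /d absz_nat coprimeXr // coprimen2 /= odd_double.
have d0 : (0 < 2 ^ J)%N by rewrite expn_gt0.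
rewrite /field qE' coprimeq_num // coprimeq_den //; split.
- rewrite pmulr_llt0 ?invr_gt0 ?ltr0n // ltrz0 /a.
  by case: neg {qE a absa cop qE'}.
- by rewrite gtr0_sg ?mul1r.
- by rewrite ifN ?absz_nat // /d; case: (2 ^ J)%N d0.
Qed.

(** * A machine for Pursuer's law *)

Section PursuitComputable.
Variables (R : realType) (n m K T0 : nat).
Hypotheses (m_gt0 : (0 < m)%N) (K_gt0 : (0 < K)%N).
Notation k0 := (1 + (n + n))%N.
Implicit Types (phi : nat -> 'rV[rat]_k0) (z : 'rV[R]_k0).

Local Open Scope nat_scope.

Definition x_index (i : nat) : 'I_k0 := inord i.+1.
Definition y_index (i : nat) : 'I_k0 := inord (n + i).+1.

(** The truncated subtraction comes last, so it produces the maximum with 0 in [time_left]. *)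
Definition clock_approx phi N :=
  T0 * 2 ^ N + scaled_neg (phi N ord0 ord0) N - scaled_pos (phi N ord0 ord0) N.
Definition up_approx i phi N :=
  scaled_pos (phi N ord0 (y_index i)) N + scaled_neg (phi N ord0 (x_index i)) N.
Definition down_approx i phi N :=
  scaled_neg (phi N ord0 (y_index i)) N + scaled_pos (phi N ord0 (x_index i)) N.
Definition abs_approx i phi N :=
  (up_approx i phi N - down_approx i phi N) + (down_approx i phi N - up_approx i phi N).
Definition gauge_approx phi N :=
  maxn (clock_approx phi N * clock_approx phi N)
       (K * K * \sum_(i < n) abs_approx i phi N * abs_approx i phi N).

(* Once the gauge is at least the square of this bound, the precision suffices
   for an output of precision [j]. *)
Definition precise j := 32 * K * m * n * n * 2 ^ j.

(** The value 0 is a dummy for oracles on which the search fails; there are none among those in the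
    domain [D] considered below. *)
Definition depth phi j : nat :=
  if pselect (exists N, precise j * precise j <= gauge_approx phi N) is left h
  then ex_minn h else 0.

(** The integer part of 2^(j+n) times the approximate |U_i|. The [n] additional bits bring the
    rounding error 2^-(j+n) / 2 of a coordinate below 2^-j / (2 n), because n <= 2^n. *)
Definition quotient_approx i phi j N :=
  2 ^ (j + n) * m * clock_approx phi N * abs_approx i phi N %/ gauge_approx phi N.

Section Cfun.
Variable D : (nat -> 'rV[rat]_k0) -> Prop.

Lemma cfun_clock k f : cfun D k f ->
  cfun D k (fun phi s => clock_approx phi (f phi s)).
Proof.
move=> cf; apply: cfun_sub; last exact: cfun_scaled_pos.
apply: cfun_add; last exact: cfun_scaled_neg.
by apply: cfun_mul; [exact: cfun_const|exact: cfun_exp].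
Qed.

Lemma cfun_up k f i : cfun D k f ->
  cfun D k (fun phi s => up_approx i phi (f phi s)).
Proof.
by move=> cf; apply: cfun_add; [exact: cfun_scaled_pos|exact: cfun_scaled_neg].
Qed.

Lemma cfun_down k f i : cfun D k f ->
  cfun D k (fun phi s => down_approx i phi (f phi s)).
Proof.
by move=> cf; apply: cfun_add; [exact: cfun_scaled_neg|exact: cfun_scaled_pos].
Qed.

Lemma cfun_abs k f i : cfun D k f ->
  cfun D k (fun phi s => abs_approx i phi (f phi s)).
Proof.
move=> cf; have cu := cfun_up i cf; have cd := cfun_down i cf.
by apply: cfun_add; exact: cfun_sub.
Qed.

Lemma cfun_gauge k f : cfun D k f ->
  cfun D k (fun phi s => gauge_approx phi (f phi s)).
Proof.
move=> cf; have cc := cfun_clock cf; apply: cfun_max; first exact: cfun_mul.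
apply: cfun_mul; first exact: cfun_const.
apply: (@cfun_sum _ _ _ _ (fun i phi s => abs_approx i phi (f phi s) * abs_approx i phi (f phi s))).
by move=> i _; apply: cfun_mul; exact: cfun_abs.
Qed.

Hypothesis deep : forall phi j, D phi ->
  exists N, precise j * precise j <= gauge_approx phi N.

Lemma depth_precise phi j : D phi ->
  precise j * precise j <= gauge_approx phi (depth phi j).
Proof.
move=> /(deep j) h; rewrite /depth; case: pselect => // h'.
by case: ex_minnP.
Qed.

Lemma cfun_depth : cfun D 1 (fun phi s => depth phi (nth 0 s 0)).
Proof.
pose t phi s := precise (nth 0 s 1) * precise (nth 0 s 1) - gauge_approx phi (nth 0 s 0).
apply: (@cfun_mu _ _ _ _ t).
- have cp : cfun D 2 (fun _ s => precise (nth 0 s 1)).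
    apply: cfun_mul; first exact: cfun_const.
    by apply: cfun_exp; exact: cfun_var.
  apply: cfun_sub; first exact: cfun_mul.
  by apply: cfun_gauge; exact: cfun_var.
- by move=> phi s Dphi _; apply/eqP; rewrite subn_eq0; exact: depth_precise.
- move=> phi s i Dphi _; rewrite /depth; case: pselect => // h.
  case: ex_minnP => N _ min iN; rewrite subn_eq0; apply/negP => /min.
  by rewrite leqNgt iN.
Qed.

Lemma precise_gt0 j : 0 < n -> 0 < precise j.
Proof. by move=> n0; rewrite /precise !muln_gt0 K_gt0 m_gt0 n0 expn_gt0. Qed.

Lemma pursuit_machine : 0 < n ->
  exists M : otm, forall phi j, D phi ->
    let N := depth phi j in
    outputs M (seq_oracle phi) (nat_code j)
      (flatten [seq triple_code (up_approx i phi N < down_approx i phi N)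
                      (quotient_approx i phi j N).*2.+1 (2 ^ (j + n).+1)
               | i <- iota 0 n]).
Proof.
move=> n0.
pose N phi (s : seq nat) := depth phi (nth 0 s 0).
pose sg i phi s : nat := up_approx i phi (N phi s) < down_approx i phi (N phi s).
pose nu i phi s := (quotient_approx i phi (nth 0 s 0) (N phi s)).*2.+1.
pose de (i : nat) phi s := 2 ^ (nth 0 s 0 + n).+1.
have cN : cfun D 1 N by exact: cfun_depth.
have ce : cfun D 1 (fun _ s => nth 0 s 0 + n).
  by apply: cfun_add; [exact: cfun_var|exact: cfun_const].
have [|M hM] := @oracle_machine _ D n sg nu de.
  move=> i _; split.
  - by apply: cfun_lt; [exact: cfun_up|exact: cfun_down].
  - have cq : cfun D 1 (fun phi s => quotient_approx i phi (nth 0 s 0) (N phi s)).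
      apply: cfun_div; last first.
      + move=> phi s Dphi _; apply: leq_trans (depth_precise _ Dphi).
        by rewrite muln_gt0 precise_gt0.
      + exact: cfun_gauge.
      apply: cfun_mul (cfun_abs _ cN); apply: cfun_mul (cfun_clock cN).
      by apply: cfun_mul (cfun_const _ _); exact: cfun_exp.
    apply: cfun_succ; apply: (cfun_ext _ (cfun_add cq cq)) => phi s _ _.
    by rewrite addnn.
  - by apply: cfun_exp; exact: cfun_succ.
exists M => phi j Dphi; apply: (hM phi j Dphi) => i _.
by rewrite /sg; case: (_ < _).
Qed.

End Cfun.

Local Close Scope nat_scope.

(** An odd numerator 2 A + 1 over 2^(J+1) stands for the midpoint of the interval between A / 2^J
    and (A + 1) / 2^J, so the output form that makes fractions reduced also halves the rounding
    error. *)
Lemma half_error (f c : R) : c <= f -> f < c + 1 -> `|f - (c + 2^-1)| <= 2^-1.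
Proof. by move=> ? ?; rewrite ler_norml; apply/andP; split; lra. Qed.

Section Error.
Variables (z : 'rV[R]_k0) (phi : nat -> 'rV[rat]_k0).
Hypothesis rep : represents phi z.

Definition time_of : R := lsubmx z ord0 ord0.
Definition gap_of : 'rV[R]_n := rsubmx (rsubmx z) - lsubmx (rsubmx z).
Definition gap_approx N : 'rV[R]_n :=
  \row_i ((up_approx i phi N)%:R - (down_approx i phi N)%:R).

Lemma clock_error N :
  `|2 ^+ N * time_left T0 time_of - (clock_approx phi N)%:R| <= 2.
Proof.
have e0 : 0 <= 2 ^+ N :> R by rewrite exprn_ge0.
have : `|2 ^+ N * time_of - ((scaled_pos (phi N ord0 ord0) N)%:R -
    (scaled_neg (phi N ord0 ord0) N)%:R)| <= 2.
  apply: scaled_approx; have := represents_dist N ord0 rep.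
  rewrite /time_of mxE; congr (`|z _ _ - _| <= _).
  by apply: val_inj.
rewrite /time_left maxr_pMr // mulr0 mulrBr /clock_approx.
set p := scaled_pos _ _; set q := scaled_neg _ _.
have -> : (T0 * 2 ^ N + q - p)%N%:R = Num.max 0 (T0%:R * 2 ^+ N + q%:R - p%:R) :> R.
  rewrite -natrX -natrM -natrD; case: (leqP p (T0 * 2 ^ N + q)) => h.
    by rewrite natrB // max_r // subr_ge0 ler_nat.
  rewrite max_l ?subr_le0 ?ler_nat 1?ltnW //.
  by have /eqP -> : (T0 * 2 ^ N + q - p == 0)%N by rewrite subn_eq0 ltnW.
set u := 2 ^+ N * time_of; rewrite [T0%:R * _]mulrC; set v := _ * T0%:R.
rewrite !ler_norml => /andP[? ?].
by case: (leP 0 (v - u)) => ?; case: (leP 0 (v + q%:R - p%:R)) => ?; apply/andP; split; lra.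
Qed.

Lemma gap_error N (i : 'I_n) :
  `|2 ^+ N * gap_of ord0 i - gap_approx N ord0 i| <= 4.
Proof.
have xi : x_index i = rshift 1 (lshift n i).
  by apply: val_inj; rewrite /= inordK; have := ltn_ord i; lia.
have yi : y_index i = rshift 1 (rshift n i).
  by apply: val_inj; rewrite /= inordK; have := ltn_ord i; lia.
have hx := scaled_approx (represents_dist N (x_index i) rep).
have hy := scaled_approx (represents_dist N (y_index i) rep).
rewrite /gap_of !mxE /up_approx /down_approx -xi -yi !natrD.
move: hx hy; rewrite !ler_norml mulrBr => /andP[? ?] /andP[? ?].
by apply/andP; split; lra.
Qed.

Lemma abs_approxE i N :
  (abs_approx i phi N)%:R = `|(up_approx i phi N)%:R - (down_approx i phi N)%:R| :> R.
Proof.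
rewrite /abs_approx; set u := up_approx _ _ _; set d := down_approx _ _ _.
case: (leqP u d) => h.
  have /eqP -> : (u - d == 0)%N by rewrite subn_eq0.
  by rewrite add0n natrB // ler0_norm ?opprB // subr_le0 ler_nat.
have /eqP -> : (d - u == 0)%N by rewrite subn_eq0 ltnW.
by rewrite addn0 natrB 1?ltnW // ger0_norm // subr_ge0 ler_nat ltnW.
Qed.

Lemma gauge_approxE N :
  (gauge_approx phi N)%:R = gauge K (clock_approx phi N)%:R (gap_approx N).
Proof.
rewrite /gauge_approx /gauge natr_max !natrM expr2; congr Num.max.
rewrite -expr2; congr (_ * _); rewrite natr_sum; apply: eq_bigr => i _.
by rewrite natrM abs_approxE !mxE -expr2 real_normK ?num_real.
Qed.

(** K times the sum of [n] coordinate errors of at most 4; it also dominates the error 2 of the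
    clock. *)
Definition approx_error : R := 4 * K%:R * n%:R.

Lemma gap_norm_error N : K%:R * enorm (2 ^+ N *: gap_of - gap_approx N) <= approx_error.
Proof.
have h : enorm (2 ^+ N *: gap_of - gap_approx N) <= n%:R * 4.
  apply: enorm_le_sum => i; have := gap_error N i.
  by rewrite !mxE.
apply: le_trans (ler_wpM2l (ler0n _ _) h) _.
by rewrite /approx_error le_eqVlt; apply/orP; left; apply/eqP; ring.
Qed.

Hypothesis n_gt0 : (0 < n)%N.

Lemma approx_error_ge : 2 <= approx_error.
Proof.
have : 1 <= (K * n)%N%:R :> R by rewrite ler1n muln_gt0 K_gt0.
by rewrite natrM /approx_error; lra.
Qed.

Lemma gsize_error N :
  `|2 ^+ N * gsize K (time_left T0 time_of) gap_of -
    gsize K (clock_approx phi N)%:R (gap_approx N)| <= approx_error.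
Proof.
rewrite -gsizeZ ?exprn_ge0 //; apply: gsize_lip; last exact: gap_norm_error.
exact: le_trans (clock_error N) approx_error_ge.
Qed.

(** The size of the scaled data is 2^N times a fixed number, positive as the gap is not 0, whereas
    its approximation error stays below [approx_error] for all [N]. Hence the search for a precision
    ends. *)
Lemma gauge_approx_unbounded B : gap_of != 0 -> exists N, (B * B <= gauge_approx phi N)%N.
Proof.
rewrite -enorm_gt0 => p0; set M := gsize K (time_left T0 time_of) gap_of.
have M0 : 0 < M by rewrite lt_max [X in _ || X]mulr_gt0 ?orbT // ltr0n.
pose c := (B%:R + approx_error) / M; pose N := (Num.truncn c).+1%N; exists N.
have cN : c <= 2 ^+ N.
  apply: ltW; apply: lt_le_trans (truncnS_gt _) _.
  by rewrite -natrX ler_nat ltnW // ltn_expl.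
have := gsize_error N; rewrite -/M ler_norml => /andP[_ h].
rewrite -(ler_nat R) natrM gauge_approxE -gsize_sqr // -expr2.
rewrite ler_sqr ?nnegrE ?gsize_ge0 //.
rewrite /c ler_pdivrMr // in cN; move: cN h.
by move: (2 ^+ N * M) approx_error (gsize _ _ _) => X E G; lra.
Qed.

Lemma pursuit_within j N : gap_of != 0 ->
  (precise j * precise j <= gauge_approx phi N)%N ->
  forall q : 'rV[rat]_n,
  (forall i : 'I_n, q ord0 i = (-1) ^+ (up_approx i phi N < down_approx i phi N)%N *
     ((quotient_approx i phi j N).*2.+1)%:R / 2 ^+ (j + n).+1) ->
  within_prec (pursuit m K T0 time_of (lsubmx (rsubmx z)) (rsubmx (rsubmx z))) q j.
Proof.
move=> p0 prec q qE; rewrite /within_prec /pursuit -/gap_of.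
set s := time_left T0 time_of; set S : R := (clock_approx phi N)%:R.
set P := gap_approx N; set E := approx_error.
have e0 : 0 < 2 ^+ N :> R by rewrite exprn_gt0.
have s0 : 0 <= s by exact: time_left_ge0.
have B0 : 0 < (precise j)%:R :> R by rewrite ltr0n precise_gt0.
have BM : (precise j)%:R <= gsize K S P.
  rewrite -ler_sqr ?nnegrE ?gsize_ge0 //.
  by rewrite gsize_sqr // -gauge_approxE expr2 -natrM ler_nat.
have M'0 : 0 < gsize K S P by exact: lt_le_trans BM.
have M0 : 0 < gsize K s gap_of.
  by rewrite lt_max [X in _ || X]mulr_gt0 ?orbT ?enorm_gt0 // ltr0n.
have eM0 : 0 < gsize K (2 ^+ N * s) (2 ^+ N *: gap_of).
  by rewrite gsizeZ; [exact: mulr_gt0|exact: (ltW e0)].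
pose eps : R := 2 ^- j / n%:R.
have n0 : 0 < n%:R :> R by rewrite ltr0n.
suff h i : `|(m%:R * s / gauge K s gap_of * gap_of ord0 i - ratr (q ord0 i)) | <= eps.
  have -> : 2 ^- j = n%:R * eps by rewrite /eps mulrC divfK // gt_eqF.
  by apply: enorm_le_sum => i; rewrite !mxE; have := h i; rewrite !mxE.
have -> : m%:R * s / gauge K s gap_of * gap_of ord0 i =
    m%:R * ((2 ^+ N * s) * (2 ^+ N *: gap_of) ord0 i / gauge K (2 ^+ N * s) (2 ^+ N *: gap_of)).
  rewrite -!gsize_sqr ?mulr_ge0 ?(ltW e0) // gsizeZ ?(ltW e0) //.
  have -> : (2 ^+ N *: gap_of) ord0 i = 2 ^+ N * gap_of ord0 i by rewrite [LHS]mxE.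
  by field; rewrite !gt_eqF.
have := @gauge_quotient_lip R n K (2 ^+ N * s) S (2 ^+ N *: gap_of) P E i K_gt0.
rewrite mulr_ge0 ?(ltW e0) // ler0n => /(_ isT isT eM0 M'0).
move=> /(_ (le_trans (clock_error N) approx_error_ge) (gap_norm_error N)).
set a := _ * _ / gauge _ _ _; set b := S * _ / _ => ab.
(* With E = 4 K n and eps = 2^-j / n, the inequality m (4 E / M') <= eps / 2 asks for M' >= 32 K m
   n^2 2^j, which is the constant in [precise]. *)
have err1 : `|m%:R * a - m%:R * b| <= eps / 2.
  rewrite -mulrBr normrM ger0_norm //.
  apply: le_trans (ler_wpM2l (ler0n _ _) ab) _.
  rewrite mulrA ler_pdivrMr //.
  apply: le_trans (ler_wpM2l _ BM); last first.
    by rewrite /eps !divr_ge0 // invr_ge0 exprn_ge0.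
  rewrite /eps /E /approx_error /precise !natrM natrX le_eqVlt; apply/orP; left.
  by apply/eqP; field; rewrite gt_eqF //= expf_neq0 // pnatr_eq0.
suff err2 : `|m%:R * b - ratr (q ord0 i)| <= eps / 2.
  have -> : m%:R * a - ratr (q ord0 i) =
    (m%:R * a - m%:R * b) + (m%:R * b - ratr (q ord0 i)) by ring.
  by apply: le_trans (ler_normD _ _) _; rewrite [eps]splitr lerD.
have W0 : (0 < gauge_approx phi N)%N.
  by apply: leq_trans prec; rewrite muln_gt0 precise_gt0.
rewrite qE; set J := (j + n)%N; set A := quotient_approx _ _ _ _.
have [] := @floor_divn R (2 ^ J * m * clock_approx phi N * abs_approx i phi N) _ W0.
rewrite -/A !natrM abs_approxE gauge_approxE natrX -/S.
set f := _ / gauge _ _ _ => fA Af.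
pose sg : R := if (up_approx i phi N < down_approx i phi N)%N then -1 else 1.
have J0 : 0 < 2 ^+ J :> R by rewrite exprn_gt0.
have W0' : gauge K S P != 0 by rewrite -gsize_sqr // expf_neq0 // gt_eqF.
have bE : m%:R * b = sg * f / 2 ^+ J.
  rewrite /b /f /sg [P _ _]mxE -/S -/P; case: ltnP => h.
    rewrite ltr0_norm ?subr_lt0 ?ltr_nat //; field.
    by rewrite W0' gt_eqF.
  rewrite ger0_norm ?subr_ge0 ?ler_nat //; field.
  by rewrite W0' gt_eqF.
have qE' : ratr ((-1) ^+ (up_approx i phi N < down_approx i phi N)%N *
   (A.*2.+1)%:R / 2 ^+ J.+1) = sg * (A%:R + 2^-1) / 2 ^+ J :> R.
  rewrite fmorph_div rmorphM rmorphXn rmorphN1 rmorph_nat rmorphXn rmorph_nat /sg.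
  have -> : (A.*2.+1)%:R = 2 * A%:R + 1 :> R by rewrite -addn1 natrD -muln2 natrM mulrC.
  rewrite exprS.
  by case: (_ < _)%N; field; rewrite gt_eqF.
rewrite bE qE' -mulrBl -mulrBr !normrM.
have -> : `|sg| = 1 by rewrite /sg; case: ifP; rewrite ?normrN1 ?normr1.
rewrite mul1r normfV (gtr0_norm J0) ler_pdivrMr //.
apply: le_trans (half_error fA Af) _.
have -> : eps / 2 * 2 ^+ J = 2^-1 * (2 ^+ n / n%:R).
  by rewrite /eps /J exprD; field; rewrite ?gt_eqF //=.
rewrite -[leLHS]mulr1 ler_wpM2l ?invr_ge0 // ler_pdivlMr // mul1r -natrX ler_nat.
by rewrite ltnW // ltn_expl.
Qed.

End Error.

Lemma pursuit_computable : (0 < n)%N ->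
  computable_on
    [set z : 'rV[R]_k0 |
      0 <= lsubmx z ord0 ord0 /\ lsubmx (rsubmx z) != rsubmx (rsubmx z)]
    (fun z => pursuit m K T0 (lsubmx z ord0 ord0) (lsubmx (rsubmx z))
                (rsubmx (rsubmx z))).
Proof.
move=> n0; set X := (X in computable_on X).
(* The oracles for which the search is guaranteed to end: those that represent some point of the
   domain. *)
pose D phi := exists2 z : 'rV[R]_k0, X z & represents phi z.
have gap0 z : X z -> gap_of z != 0 by case=> _ xy; rewrite subr_eq0 eq_sym.
have deep phi j : D phi -> exists N, (precise j * precise j <= gauge_approx phi N)%N.
  by move=> [z /gap0 g rep]; exact: gauge_approx_unbounded rep n0 _ g.
have [M hM] := pursuit_machine deep n0.
exists M => z Xz phi rep j; pose N := depth phi j.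
have Dphi : D phi by exists z.
pose q : 'rV[rat]_n := \row_i ((-1) ^+ (up_approx i phi N < down_approx i phi N)%N *
   ((quotient_approx i phi j N).*2.+1)%:R / 2 ^+ (j + n).+1).
exists q; last first.
  apply: (pursuit_within rep n0 (gap0 _ Xz) (depth_precise deep j Dphi)) => i.
  by rewrite mxE.
rewrite -(@ratpoint_triples n q (fun i => up_approx i phi N < down_approx i phi N : nat)%N
  (fun i => (quotient_approx i phi j N).*2.+1)%N (fun=> 2 ^ (j + n).+1)%N).
  exact: hM.
move=> i; have [|-> -> ->] := @field_odd_dyadic (up_approx i phi N < down_approx i phi N)%N
  (quotient_approx i phi j N) (j + n).+1%N (q ord0 i) => //.
by rewrite mxE.
Qed.

End PursuitComputable.

(** * Derivatives of scalar components *)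

Section Components.
Local Open Scope classical_set_scope.
Variable R : realType.
Implicit Types (D : set R) (f g : R -> R) (t d : R).

Lemma cvg_row (T : Type) (F : set_system T) (FF : Filter F) n
    (h : T -> 'rV[R]_n) (l : 'rV[R]_n) :
  h @ F --> l <-> forall i, h x ord0 i @[x --> F] --> l ord0 i.
Proof.
split=> [hl i|hl].
  exact: (cvg_comp _ _ hl (@coord_continuous _ _ _ ord0 i l)).
apply/cvg_ballP => e e0; near=> x; split => // i j; rewrite ord1.
move: j; near: x; apply: filter_forall => j.
by move/cvg_ballP : (hl j) => /(_ e e0).
Unshelve. all: by end_near. Qed.

Definition der_within D f t d : Prop :=
  (s - t)^-1 * (f s - f t) @[s --> within D t^'] --> d.

Lemma has_derivative_within_coord n D (x : R -> 'rV[R]_n) t (d : 'rV[R]_n) :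
  has_derivative_within D x t d <->
  forall i, der_within D (fun s => x s ord0 i) t (d ord0 i).
Proof.
rewrite /has_derivative_within /der_within cvg_row.
have e i : (fun s => ((s - t)^-1 *: (x s - x t)) ord0 i) =
    (fun s => (s - t)^-1 * (x s ord0 i - x t ord0 i)).
  by apply/funext => s; rewrite !mxE.
by split=> h i; have := h i; rewrite e.
Qed.

Lemma der_withinP D f t d : der_within D f t d <->
  forall e, 0 < e -> exists2 r, 0 < r &
    forall s, D s -> s != t -> `|s - t| < r -> `|(s - t)^-1 * (f s - f t) - d| < e.
Proof.
split=> [/cvgrPdist_lt h e /h|h].
  move=> /nbhs_ballP[r /= r0 hr]; exists r => // s Ds st sr.
  by rewrite distrC; apply: (hr s) => //; rewrite /ball /= distrC.
apply/cvgrPdist_lt => e /h[r r0 hr]; apply/nbhs_ballP; exists r => //= s sr st Ds.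
by rewrite distrC; apply: hr => //; rewrite distrC.
Qed.

Lemma withinP D f t l : f s @[s --> within D (nbhs t)] --> l <->
  forall e, 0 < e -> exists2 r, 0 < r &
    forall s, D s -> `|s - t| < r -> `|f s - l| < e.
Proof.
split=> [/cvgrPdist_lt h e /h|h].
  move=> /nbhs_ballP[r /= r0 hr]; exists r => // s Ds sr.
  by rewrite distrC; apply: (hr s) => //; rewrite /ball /= distrC.
apply/cvgrPdist_lt => e /h[r r0 hr]; apply/nbhs_ballP; exists r => //= s sr Ds.
by rewrite distrC; apply: hr => //; rewrite distrC.
Qed.

Lemma is_deriveP f t d : is_derive t 1 f d <-> der_within setT f t d.
Proof.
have e : h^-1 *: ((f \o shift t) (h *: 1) - f t) @[h --> 0^'] --> d <-> der_within setT f t d.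
  split=> [/cvgrPdist_lt hd|/der_withinP hd].
    apply/der_withinP => e /hd /nbhs_ballP[r /= r0 hr]; exists r => // s _ st sr.
    have := hr (s - t); rewrite /ball /= sub0r normrN subr_eq0 => /(_ sr st).
    by rewrite distrC [_ *: 1]mulr1 subrK.
  apply/cvgrPdist_lt => e /hd[r r0 hr]; apply/nbhs_ballP; exists r => //= h.
  rewrite /ball /= sub0r normrN => hr' h0; rewrite distrC [_ *: 1]mulr1.
  by have := hr (h + t) I; rewrite addrK => -> //; rewrite -subr_eq0 addrK.
split=> [[df dE]|/e h]; first by apply/e; rewrite -dE; exact: df.
split; first by apply/cvg_ex; exists d.
exact: (cvg_lim (@Rhausdorff R) h).
Qed.

Lemma der_within_subset D D' f t d : D' `<=` D -> der_within D f t d -> der_within D' f t d.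
Proof.
by move=> DD /der_withinP h; apply/der_withinP => e /h[r r0 hr]; exists r => // s /DD; exact: hr.
Qed.

Lemma der_within_interior D f t d r : 0 < r -> (forall s, `|s - t| < r -> D s) ->
  der_within D f t d -> is_derive t 1 f d.
Proof.
move=> r0 hD /der_withinP h; apply/is_deriveP/der_withinP => e /h[r' r'0 hr].
exists (Num.min r r'); first by rewrite lt_min r0.
by move=> s _ st; rewrite lt_min => /andP[/hD Ds]; exact: hr.
Qed.

Lemma is_derive_der_within D f t d : is_derive t 1 f d -> der_within D f t d.
Proof. by move=> /is_deriveP; exact: der_within_subset. Qed.

Lemma der_within_cvg D f t d : der_within D f t d -> f s @[s --> within D (nbhs t)] --> f t.
Proof.
move=> /der_withinP /(_ 1 ltr01)[r r0 hr]; apply/withinP => e e0.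
have k0 : 0 < `|d| + 1 by rewrite ltr_wpDl.
exists (Num.min r (e / (`|d| + 1))); first by rewrite lt_min r0 divr_gt0.
move=> s Ds; rewrite lt_min => /andP[sr]; rewrite ltr_pdivlMr // => se.
have [->|st] := eqVneq s t; first by rewrite subrr normr0.
have st0 : s - t != 0 by rewrite subr_eq0.
apply: le_lt_trans se; rewrite -ler_pdivrMl ?normr_gt0 // -normfV -normrM.
rewrite -[X in `|X|](subrK d) addrC; apply: le_trans (ler_normD _ _) _.
by rewrite lerD2l ltW // hr.
Qed.

Lemma within_continuousP D f : {within D, continuous f} <->
  forall t, D t -> f s @[s --> within D (nbhs t)] --> f t.
Proof. exact: subspace_continuousP. Qed.

Lemma mean_value f (df : R -> R) a b : a <= b ->
  {within `[a, b], continuous f} ->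
  (forall t, a < t < b -> der_within `[a, b] f t (df t)) ->
  exists2 c, a <= c <= b & f b - f a = df c * (b - a).
Proof.
rewrite le_eqVlt => /predU1P[->|ab] fc fd.
  by exists b; rewrite ?lexx // !subrr mulr0.
have [t tab|//|c cab ->] := @MVT R f df a b ab.
  have tab' : a < t < b by move: tab; rewrite in_itv.
  apply: (@der_within_interior `[a, b] _ _ _ (Num.min (t - a) (b - t))) (fd t tab').
    by rewrite lt_min !subr_gt0.
  move=> s; rewrite lt_min => /andP[]; rewrite !ltr_norml => /andP[? ?] /andP[? ?].
  by rewrite /= in_itv /=; apply/andP; split; lra.
by exists c => //; move: cab; rewrite in_itv /= => /andP[/ltW-> /ltW->].
Qed.

(** [T] is the infimum of the times with a nonnegative value. Such times arbitrarily close to [T]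
    exclude [f T < 0], and earlier times, where [f] is negative, exclude [f T > 0]. *)
Lemma first_hit f a b : a <= b -> {within `[a, b], continuous f} ->
  f a < 0 -> 0 <= f b ->
  exists T, [/\ a < T <= b, f T = 0 & forall t, a <= t < T -> f t < 0].
Proof.
move=> ab /within_continuousP fc fa fb.
pose Z : set R := [set t | (a <= t <= b) && (0 <= f t)].
have Zb : Z b by rewrite /Z /= ab lexx.
have lbZ : lbound Z a by move=> t /andP[/andP[]].
have hZ : has_inf Z by split; [exists b|exists a].
pose T := inf Z.
have aT : a <= T by apply: lb_le_inf => //; exists b.
have Tb : T <= b by apply: ge_inf => //; exists a.
have lt t : a <= t < T -> f t < 0.
  move=> /andP[at_ tT]; rewrite ltNge; apply/negP => ft.
  have : T <= t.
    by apply: ge_inf; [exists a|rewrite /Z /= at_ ft (le_trans (ltW tT) Tb)].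
  by rewrite leNgt tT.
have fcT : f s @[s --> within `[a, b] (nbhs T)] --> f T.
  by apply: fc; rewrite /= in_itv /= aT Tb.
have fT0 : 0 <= f T.
  rewrite leNgt; apply/negP => fT.
  move/withinP : fcT => /(_ (- f T)); rewrite oppr_gt0 => /(_ fT)[r r0 hr].
  have [t /andP[/andP[at_ tb] ft] tT] := inf_adherent r0 hZ.
  have Tt : T <= t by apply: ge_inf; [exists a|rewrite /Z /= at_ tb].
  have := hr t; rewrite /= in_itv /= at_ tb ger0_norm ?subr_ge0 // ltrBlDl.
  move=> /(_ isT tT); rewrite ltr_norml => /andP[_]; rewrite ltrBlDr.
  by rewrite addNr ltNge ft.
have aT' : a < T.
  by rewrite lt_def aT andbT; apply/eqP => Ta; move: fT0; rewrite Ta leNgt fa.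
exists T; split => //; first by rewrite aT'.
apply/eqP; rewrite eq_le fT0 andbT leNgt; apply/negP => fT.
move/withinP : fcT => /(_ _ fT)[r r0 hr].
pose s := Num.max a (T - r / 2).
have sT : s < T by rewrite gt_max aT' ltrBlDr ltrDl divr_gt0.
have as_ : a <= s by rewrite le_max lexx.
have fs : f s < 0 by apply: lt; rewrite as_.
have : T - r / 2 <= s by rewrite le_max lexx orbT.
move=> rs; have := hr s; rewrite /= in_itv /= as_ (le_trans (ltW sT) Tb) => /(_ isT).
rewrite ltr0_norm ?subr_lt0 // opprB ltr_norml => /(_ _)/andP[]; first by lra.
by lra.
Qed.

End Components.

(** * Rules for relative derivatives, and Evader's escape *)

Section Calculus.
Local Open Scope classical_set_scope.
Variable R : realType.
Implicit Types (D : set R) (f g : R -> R) (t d : R).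

Lemma der_within_cst D c t : der_within D (fun=> c) t 0.
Proof.
apply/der_withinP => e e0; exists 1 => // s _ _ _.
by rewrite subrr mulr0 subrr normr0.
Qed.

Lemma der_within_id D t : der_within D id t 1.
Proof.
apply/der_withinP => e e0; exists 1 => // s _ st _.
by rewrite mulVf ?subrr ?normr0 // subr_eq0.
Qed.

Lemma der_withinD D f g t df dg : der_within D f t df -> der_within D g t dg ->
  der_within D (fun s => f s + g s) t (df + dg).
Proof.
move=> hf hg; rewrite /der_within.
have -> : (fun s => (s - t)^-1 * (f s + g s - (f t + g t))) =
  (fun s => (s - t)^-1 * (f s - f t) + (s - t)^-1 * (g s - g t)).
  by apply/funext => s; ring.
exact: cvgD hf hg.
Qed.

Lemma within_dnbhs D t : within D t^' `=>` within D (nbhs t).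
Proof. by move=> P h; apply: (@filterS _ (nbhs t) _ _ _ _ h) => s Ds _. Qed.

Lemma der_withinM D f g t df dg : der_within D f t df -> der_within D g t dg ->
  der_within D (fun s => f s * g s) t (f t * dg + df * g t).
Proof.
move=> hf hg; rewrite /der_within.
have -> : (fun s => (s - t)^-1 * (f s * g s - (f t * g t))) =
  (fun s => f s * ((s - t)^-1 * (g s - g t)) + (s - t)^-1 * (f s - f t) * g t).
  by apply/funext => s; ring.
apply: cvgD; last by apply: cvgM => //; exact: cvg_cst.
apply: cvgM => //; apply: cvg_trans (der_within_cvg hf).
by apply: cvg_app; exact: within_dnbhs.
Qed.

Lemma der_withinZ D c f t df : der_within D f t df -> der_within D (fun s => c * f s) t (c * df).
Proof.
move=> hf; have := der_withinM (der_within_cst D c t) hf.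
by rewrite mul0r addr0.
Qed.

Lemma der_withinB D f g t df dg : der_within D f t df -> der_within D g t dg ->
  der_within D (fun s => f s - g s) t (df - dg).
Proof.
move=> hf hg; have := der_withinD hf (@der_withinZ D (-1) g t dg hg).
by rewrite mulN1r; under eq_fun do rewrite mulN1r.
Qed.

Lemma der_within_near D f g t d r : 0 < r -> (forall s, `|s - t| < r -> f s = g s) ->
  der_within D f t d -> der_within D g t d.
Proof.
move=> r0 fg /der_withinP h; apply/der_withinP => e /h[r' r'0 hr].
exists (Num.min r r'); first by rewrite lt_min r0.
move=> s Ds st; rewrite lt_min => /andP[/fg <- sr].
by rewrite -(fg t) ?subrr ?normr0 //; exact: hr.
Qed.

Lemma der_within_dot n D (p q : R -> 'rV[R]_n) t (dp dq : 'rV[R]_n) :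
  (forall i, der_within D (fun s => p s ord0 i) t (dp ord0 i)) ->
  (forall i, der_within D (fun s => q s ord0 i) t (dq ord0 i)) ->
  der_within D (fun s => dot (p s) (q s)) t (dot (p t) dq + dot dp (q t)).
Proof.
move=> hp hq; rewrite /der_within /dot -big_split /=.
have -> : (fun s => (s - t)^-1 * (\sum_i p s ord0 i * q s ord0 i -
     \sum_i p t ord0 i * q t ord0 i)) =
   (fun s => \sum_i (s - t)^-1 * (p s ord0 i * q s ord0 i - p t ord0 i * q t ord0 i)).
  by apply/funext => s; rewrite -sumrB mulr_sumr.
by apply: cvg_big => [|i _]; [exact: add_continuous|exact: der_withinM].
Qed.

Lemma cvg_dot (T : Type) (F : set_system T) (FF : Filter F) n
    (p q : T -> 'rV[R]_n) (lp lq : 'rV[R]_n) :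
  (forall i, p x ord0 i @[x --> F] --> lp ord0 i) ->
  (forall i, q x ord0 i @[x --> F] --> lq ord0 i) ->
  dot (p x) (q x) @[x --> F] --> dot lp lq.
Proof.
move=> hp hq; apply: cvg_big => [|i _]; first exact: add_continuous.
exact: cvgM.
Qed.

Lemma within_subset_cvg D D' f t (l : R) : D' `<=` D ->
  f s @[s --> within D (nbhs t)] --> l -> f s @[s --> within D' (nbhs t)] --> l.
Proof.
move=> DD /withinP h; apply/withinP => e /h[r r0 hr].
by exists r => // s /DD; exact: hr.
Qed.

Lemma trajectory_der_within n (p : 'rV[R]_n) u x t D i : trajectory p u x -> 0 <= t ->
  D `<=` `[0, +oo[ -> der_within D (fun s => x s ord0 i) t (u t ord0 i).
Proof.
by move=> [_ h] t0 DD; apply: der_within_subset DD _; have /has_derivative_within_coord := h t t0.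
Qed.

Lemma segment_ray (t : R) : `[0, t] `<=` `[0, +oo[.
Proof. by move=> s /=; rewrite !in_itv /= => /andP[->]. Qed.

(** If a catch occurred at time [t], then [e] would be Pursuer's displacement. Testing the
    displacement against the fixed vector [e] needs the mean value theorem for a scalar function
    only, and gives |e| <= a t. *)
Lemma evader_escape n a b (x0 y0 w : 'rV[R]_n) u x y t :
  0 <= a <= b -> enorm w = b -> 0 <= dot (y0 - x0) w -> x0 != y0 ->
  (forall s, 0 <= s -> enorm (u s) <= a) ->
  trajectory x0 u x -> trajectory y0 (fun=> w) y -> 0 <= t -> x t != y t.
Proof.
move=> /andP[a0 ab] wb yw xy0 ua tx ty t0; apply/eqP => xy.
pose e := y0 - x0 + t *: w.
have yt : y t = y0 + t *: w.
  apply/rowP => i; rewrite !mxE.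
  have [||c _] := @mean_value R (fun s => y s ord0 i) (fun=> w ord0 i) 0 t t0.
  - apply/within_continuousP => s; rewrite /= in_itv /= => /andP[s0 _].
    exact: (der_within_cvg (trajectory_der_within ty s0 (@segment_ray t))).
  - move=> s /andP[s0 _].
    by have := trajectory_der_within ty (ltW s0) (@segment_ray t).
  by rewrite (proj1 ty) subr0 [t * _]mulrC => <-; rewrite addrC subrK.
have he : dot e e <= enorm e * (a * t).
  have [||c /andP[c0 _]] :=
    @mean_value R (fun s => dot e (x s)) (fun s => dot e (u s)) 0 t t0.
  - apply/within_continuousP => s; rewrite /= in_itv /= => /andP[s0 _].
    apply: cvg_dot => i; first exact: cvg_cst.
    exact: (der_within_cvg (trajectory_der_within tx s0 (@segment_ray t))).
  - move=> s /andP[/ltW s0 _].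
    have -> : dot e (u s) = dot e (u s) + dot 0 (x s).
      by rewrite -(scale0r (x s)) dotZl mul0r addr0.
    apply: der_within_dot => i.
      by rewrite [X in der_within _ _ _ X](_ : _ = 0); [exact: der_within_cst|rewrite mxE].
    exact: (trajectory_der_within tx s0 (@segment_ray t)).
  rewrite (proj1 tx) xy subr0 => h.
  have -> : dot e e = dot e (y t) - dot e x0.
    by rewrite -[in RHS]mulN1r -dotZr -dotDr yt scaleN1r addrAC.
  rewrite h mulrA ler_wpM2r //; apply: le_trans (cauchy_schwarz _ _) _.
  by rewrite ler_wpM2l ?enorm_ge0 // ua.
have ee : dot e e = dot (y0 - x0) (y0 - x0) + 2 * t * dot (y0 - x0) w + t ^+ 2 * b ^+ 2.
  rewrite /e -wb enorm_sqr; move: (y0 - x0) => d.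
  by rewrite dotDl !dotDr !dotZl !dotZr (dotC w d); ring.
have w0 : 0 < dot (y0 - x0) (y0 - x0).
  by rewrite lt_def dot_ge0 dot_eq0 subr_eq0 eq_sym xy0.
have lt_e : (a * t) ^+ 2 < enorm e ^+ 2.
  rewrite enorm_sqr ee exprMn.
  have : a ^+ 2 * t ^+ 2 <= t ^+ 2 * b ^+ 2.
    by rewrite mulrC ler_wpM2l ?sqr_ge0 // ler_sqr ?nnegrE // (le_trans a0).
  have : 0 <= 2 * t * dot (y0 - x0) w by rewrite !mulr_ge0.
  by move: w0; lra.
have at0 : 0 <= a * t by rewrite mulr_ge0.
have lt_e' : a * t < enorm e by rewrite -ltr_sqr ?nnegrE ?enorm_ge0.
move: he; rewrite -enorm_sqr expr2 ler_pM2l ?leNgt ?lt_e' //.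
exact: le_lt_trans lt_e'.
Qed.

End Calculus.

Lemma der_withinX (R : realType) (D : set R) f (t d : R) k : der_within D f t d ->
  der_within D (fun s => f s ^+ k) t (k%:R * f t ^+ k.-1 * d).
Proof.
move=> fd; elim: k => [|k IHk]; first by rewrite !mul0r; exact: der_within_cst.
have := der_withinM fd IHk; congr (der_within _ _ _ _).
  by apply/funext => s; rewrite exprS.
case: k {IHk} => [|k] /=; first by rewrite !expr0; ring.
by rewrite -[k.+2%:R]natr1 exprS; ring.
Qed.

Section LinearEquation.
Local Open Scope classical_set_scope.
Variables (R : realType) (m : nat) (T0 : R).
Hypothesis T0_gt0 : 0 < T0.

(* Variation of constants: (T0 - t)^m solves the homogeneous equation. *)
Lemma linear_solution (y : R -> R) (c : R) :
  (forall t : R, 0 <= t -> y s @[s --> within `[0, +oo[ (nbhs t)] --> y t) ->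
  exists2 x : R -> R, x 0 = c &
    forall t : R, 0 <= t < T0 -> is_derive t 1 x (m%:R / (T0 - t) * (y t - x t)).
Proof.
(* Continuing y by the value y 0 to negative times makes the integrand continuous on both sides of
   0. *)
move=> yc; pose y' (t : R) := y (Num.max t 0).
pose rho : R -> R := fun t => T0 - t.
pose h : R -> R := fun t => m%:R * (rho t)^-1 ^+ m.+1 * y' t.
have rhoc (t : R) : rho s @[s --> t] --> rho t by apply: cvgB; [exact: cvg_cst|exact: cvg_id].
have y'c (t : R) : y' s @[s --> t] --> y' t.
  apply/cvgrPdist_lt => e e0.
  have m0 : 0 <= Num.max t 0 by rewrite le_max lexx orbT.
  have /withinP/(_ e e0)[r r0 hr] := yc _ m0.
  apply/nbhs_ballP; exists r => //= s; rewrite /ball /= => ts.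
  rewrite distrC; apply: hr; first by rewrite /= in_itv /= le_max lexx orbT.
  apply: le_lt_trans ts; rewrite distrC.
  by case: (leP s 0) => ?; case: (leP t 0) => ?; rewrite ler_norml;
    case: (ger0P (t - s)) => ?; apply/andP; split; lra.
have hc (t : R) : t < T0 -> h s @[s --> t] --> h t.
  move=> tT; apply: cvgM (y'c t); apply: cvgM; first exact: cvg_cst.
  apply: (cvg_comp (fun s => (rho s)^-1) (fun r => r ^+ m.+1)).
    by apply: cvgV (rhoc t); rewrite /rho subr_eq0 gt_eqF.
  exact: exprn_continuous.
pose mu := @lebesgue_measure R.
(* The lower limit -1 makes every t >= 0 an interior point, so the derivative at 0 is two-sided; the
   initial value is restored in [z] by subtracting F 0. *)
pose F (t : R) : R := (\int[mu]_(s in `[(-1 : R), t]) h s)%R.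
have FD (t : R) : 0 <= t < T0 -> is_derive t 1 F (h t).
  move=> /andP[t0 tT].
  (* The integrand may blow up at T0, so integrability is needed, and shown, only up to this
     midpoint. *)
  have tu : t < (t + T0) / 2 by lra.
  have uT : (t + T0) / 2 < T0 by lra.
  have int : mu.-integrable `[(-1 : R), (t + T0) / 2] (EFin \o h).
    apply: continuous_compact_integrable; first exact: segment_compact.
    apply/within_continuousP => s; rewrite /= in_itv /= => /andP[_ su].
    by apply: cvg_within_filter; apply: hc; exact: le_lt_trans uT.
  have [] := @continuous_FTC1_closed R h (-1) t _ tu int _ (hc _ tT); first lra.
  by move=> d <-; rewrite derive1E; exact: DeriveDef.
pose z (t : R) : R := F t - F 0 + c / T0 ^+ m.
exists (fun t => rho t ^+ m * z t).
  by rewrite /rho /z subr0 subrr add0r mulrC divfK // expf_neq0 // gt_eqF.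
move=> t tT; have /andP[t0 t1] := tT.
have rD : der_within setT rho t (0 - 1).
  exact: der_withinB (der_within_cst _ _ _) (der_within_id _ _).
have zD : der_within setT z t (h t - 0 + 0).
  by apply: der_withinD (der_within_cst _ _ _); apply: der_withinB (der_within_cst _ _ _);
    apply/is_deriveP/FD.
apply/is_deriveP; move: (der_withinM (der_withinX (k := m) rD) zD); rewrite /h /y' max_l //.
have r0 : rho t != 0 by rewrite subr_eq0 gt_eqF.
congr (der_within _ _ _ _); rewrite -/(rho t).
move: (z t) => zt; case: (m) => [|k]; rewrite ?expr0 ?expr1 /=; first by field.
by rewrite !exprS !exprVn; field; rewrite r0 expf_neq0.
Qed.

End LinearEquation.

(** * The plays of Pursuer's law *)

Section Chase.
Local Open Scope classical_set_scope.
Variables (R : realType) (n m K T0 : nat) (b : R).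
Variables (x0 y0 : 'rV[R]_n) (v y : R -> 'rV[R]_n).
Hypotheses (K_gt0 : (0 < K)%N) (slow : K%:R * b < m%:R - 1)
  (near_start : K%:R * enorm (y0 - x0) < T0%:R) (x0_neq_y0 : x0 != y0)
  (v_le : forall t : R, 0 <= t -> enorm (v t) <= b) (yv : trajectory y0 v y).

Local Notation U := (pursuit (R := R) (n := n) m K T0).

Let K0 : 0 < K%:R :> R. Proof. by rewrite ltr0n. Qed.

Let T0_gt0 : 0 < T0%:R :> R.
Proof. by apply: le_lt_trans near_start; rewrite mulr_ge0 ?enorm_ge0. Qed.

Lemma gauge_le (s : R) (p : 'rV[R]_n) : 0 <= s ->
  K%:R ^+ 2 * dot p p <= s ^+ 2 <-> K%:R * enorm p <= s.
Proof.
move=> s0; rewrite -enorm_sqr -exprMn ler_sqr ?nnegrE //.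
by rewrite mulr_ge0 ?enorm_ge0.
Qed.

Lemma pursuit_linear (t : R) (x z : 'rV[R]_n) : t < T0%:R ->
  K%:R ^+ 2 * dot (z - x) (z - x) <= (T0%:R - t) ^+ 2 ->
  U t x z = (m%:R / (T0%:R - t)) *: (z - x).
Proof.
move=> tT h; rewrite /pursuit /gauge /time_left max_r ?subr_ge0 ?(ltW tT) //.
rewrite max_l //; congr (_ *: _); field.
by rewrite subr_eq0 gt_eqF.
Qed.

(** K |p| - (T0 - t) in squared form, which is differentiable also where p = 0. The factor [-1] is
    the form that the product rules deliver. *)
Let phi (x : R -> 'rV[R]_n) (t : R) : R :=
  K%:R ^+ 2 * dot (y t - x t) (y t - x t) + -1 * (T0%:R - t) ^+ 2.

Lemma cvg_phi (x : R -> 'rV[R]_n) (F : set_system R) (FF : Filter F) (t : R) :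
  id @ F --> t ->
  (forall i, y s ord0 i @[s --> F] --> y t ord0 i) ->
  (forall i, x s ord0 i @[s --> F] --> x t ord0 i) -> phi x s @[s --> F] --> phi x t.
Proof.
move=> idc yc xc.
have pc i : (y s - x s) ord0 i @[s --> F] --> (y t - x t) ord0 i.
  under eq_cvg do rewrite !mxE.
  by rewrite !mxE; exact: cvgB.
apply: cvgD; apply: cvgM; try exact: cvg_cst; first exact: cvg_dot.
have rc : T0%:R - s @[s --> F] --> T0%:R - t by apply: cvgB idc; exact: cvg_cst.
exact: (cvg_comp _ _ rc (@exprn_continuous R 2 _)).
Qed.

Lemma y_cvg (D : set R) (t : R) i : D `<=` `[0, +oo[ -> 0 <= t ->
  y s ord0 i @[s --> within D (nbhs t)] --> y t ord0 i.
Proof. by move=> DD t0; exact: der_within_cvg (trajectory_der_within yv t0 DD). Qed.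

Lemma cvg_id_within (D : set R) (t : R) : id @ within D (nbhs t) --> t.
Proof. by apply: cvg_within_filter; exact: cvg_id. Qed.

(* At a first time with K|p| = T0 - t the gap p = y - x would shrink fast
   enough for K|p| - (T0 - t) to be decreasing there. *)
Lemma barrier (tau : R) (x : R -> 'rV[R]_n) : tau <= T0%:R -> x 0 = x0 ->
  (forall (t : R) i, 0 <= t < tau ->
     x s ord0 i @[s --> within `[0, tau] (nbhs t)] --> x t ord0 i) ->
  (forall t : R, 0 < t < tau ->
     K%:R ^+ 2 * dot (y t - x t) (y t - x t) = (T0%:R - t) ^+ 2 ->
     forall i, der_within `[0, tau] (fun s => x s ord0 i) t
       ((m%:R / (T0%:R - t) *: (y t - x t)) ord0 i)) ->
  forall t : R, 0 <= t < tau -> K%:R * enorm (y t - x t) < T0%:R - t.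
Proof.
move=> tauT xx0 xc xd t /andP[t0 ttau].
suff : phi x t < 0.
  rewrite /phi mulN1r subr_lt0 -enorm_sqr -exprMn ltr_sqr ?nnegrE //.
    by rewrite mulr_ge0 ?enorm_ge0.
  by rewrite subr_ge0 (le_trans (ltW ttau)).
rewrite ltNge; apply/negP => phit.
have sub : `[0, t] `<=` `[0, tau].
  by move=> s; rewrite /= !in_itv /= => /andP[-> st]; rewrite (le_trans st) // ltW.
have [||T [/andP[T_gt0 Tt] phiT before]] := @first_hit R (phi x) 0 t t0 _ _ phit.
- apply/within_continuousP => s; rewrite /= in_itv /= => /andP[s0 st].
  apply: cvg_phi => [|i|i].
  + exact: cvg_id_within.
  + by apply: y_cvg => //; exact: segment_ray.
  + by apply: within_subset_cvg sub _; apply: xc; rewrite s0 (le_lt_trans st).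
- rewrite /phi (proj1 yv) xx0 mulN1r subr0 subr_lt0 -enorm_sqr -exprMn.
  by rewrite ltr_sqr ?nnegrE ?mulr_ge0 ?enorm_ge0.
have Ttau : T < tau by exact: le_lt_trans ttau.
have TT0 : 0 < T0%:R - T by rewrite subr_gt0 (lt_le_trans Ttau).
have eT : K%:R ^+ 2 * dot (y T - x T) (y T - x T) = (T0%:R - T) ^+ 2.
  by apply/eqP; rewrite -subr_eq0 -mulN1r; apply/eqP.
have tray : `[0, tau] `<=` `[0, +oo[ by exact: segment_ray.
set p := y T - x T in eT; set g := (m%:R / (T0%:R - T)) *: p.
have pd i : der_within `[0, tau] (fun s => (y s - x s) ord0 i) T ((v T - g) ord0 i).
  have := der_withinB (trajectory_der_within (i := i) yv (ltW T_gt0) tray)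
    (xd T _ eT i); rewrite T_gt0 Ttau => /(_ isT).
  congr (der_within _ _ _ _); last by rewrite !mxE.
  by apply/funext => s; rewrite !mxE.
have phid := der_withinD (der_withinZ (c := K%:R ^+ 2) (der_within_dot pd pd))
  (der_withinZ (c := -1) (der_withinX (k := 2)
     (der_withinB (der_within_cst `[0, tau] T0%:R T) (der_within_id _ T)))).
set d := (X in der_within _ _ _ X) in phid.
have d0 : d < 0.
  have Kp : K%:R * enorm p = T0%:R - T.
    apply/eqP; rewrite -(@eqrXn2 _ 2) ?mulr_ge0 ?enorm_ge0 ?(ltW TT0) //.
    by rewrite exprMn enorm_sqr eT.
  (* At the touching time K^2 |p|^2 = (T0 - T)^2, so the pull towards Evader contributes -2 m (T0 -
     T) and the clock +2 (T0 - T). *)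
  have dE : d = 2 * (K%:R ^+ 2 * dot (v T) p) - 2 * (m%:R - 1) * (T0%:R - T).
    have pg : K%:R ^+ 2 * dot g p = m%:R * (T0%:R - T).
      rewrite /g dotZl mulrCA eT; field.
      by rewrite gt_eqF.
    rewrite /d -/p (dotC p) -scaleN1r dotDl dotZl.
    have -> : K%:R ^+ 2 * (dot (v T) p + -1 * dot g p + (dot (v T) p + -1 * dot g p)) =
       2 * (K%:R ^+ 2 * dot (v T) p) - 2 * (K%:R ^+ 2 * dot g p) by ring.
    by rewrite pg expr1; ring.
  have vp : K%:R ^+ 2 * dot (v T) p <= K%:R * b * (T0%:R - T).
    rewrite -Kp expr2 -!mulrA ler_wpM2l // mulrCA ler_wpM2l //.
    apply: le_trans (cauchy_schwarz _ _) _.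
    by rewrite ler_wpM2r ?enorm_ge0 // v_le // ltW.
  have : K%:R * b * (T0%:R - T) < (m%:R - 1) * (T0%:R - T) by rewrite ltr_pM2r.
  by rewrite dE; lra.
have := phid; rewrite -/(phi x) => /der_withinP/(_ (- d)); rewrite oppr_gt0 => /(_ d0)[r r0 hr].
(* At such an earlier time [phi] is negative, while it vanishes at [T]. The difference quotient is
   therefore nonnegative and cannot be within -d of the negative number d. *)
pose s := Num.max 0 (T - r / 2).
have sT : s < T by rewrite gt_max T_gt0 ltrBlDr ltrDl divr_gt0.
have s0 : 0 <= s by rewrite le_max lexx.
have rs : T - r / 2 <= s by rewrite le_max lexx orbT.
have phis : phi x s < 0 by apply: before; rewrite s0.
have := hr s; rewrite /= in_itv /= s0 (ltW (lt_trans sT Ttau)) lt_eqF //.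
rewrite ltr0_norm ?subr_lt0 // opprB => /(_ isT isT).
rewrite -/(phi x s) -/(phi x T) phiT subr0 ltr_norml => h.
have /h/andP[_] : T - s < r by lra.
rewrite ltrBlDr addNr ltNge; apply/negP/negPn.
by rewrite nmulr_rge0 ?invr_lt0 ?subr_lt0 // ltW.
Qed.

(* The difference e of two plays satisfies (e^2)' <= 0. *)
Lemma linear_unique (tau : R) (f g c : R -> R) : tau <= T0%:R ->
  {within `[0, tau], continuous f} -> {within `[0, tau], continuous g} ->
  f 0 = g 0 ->
  (forall t : R, 0 < t < tau -> der_within `[0, tau] f t (m%:R / (T0%:R - t) * (c t - f t))) ->
  (forall t : R, 0 < t < tau -> der_within `[0, tau] g t (m%:R / (T0%:R - t) * (c t - g t))) ->
  forall t : R, 0 <= t <= tau -> f t = g t.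
Proof.
move=> tauT fc gc fg0 fd gd t /andP[t0 ttau].
pose e (s : R) : R := (f s - g s) * (f s - g s).
pose de (s : R) : R := (f s - g s) * (- (m%:R / (T0%:R - s)) * (f s - g s)) +
             (- (m%:R / (T0%:R - s)) * (f s - g s)) * (f s - g s).
have sub : `[0, t] `<=` `[0, tau].
  by move=> s; rewrite /= !in_itv /= => /andP[-> st]; rewrite (le_trans st).
have [||k /andP[k0 kt]] := @mean_value R e de 0 t t0.
- apply/within_continuousP => s /sub ss.
  have hf := (within_continuousP _ _).1 fc s ss.
  have hg := (within_continuousP _ _).1 gc s ss.
  by apply: within_subset_cvg sub _; apply: cvgM; exact: cvgB.
- move=> s /andP[s0 st].
  have ss : 0 < s < tau by rewrite s0 (lt_le_trans st).
  have hd : der_within `[0, tau] (fun s => f s - g s) s (- (m%:R / (T0%:R - s)) * (f s - g s)).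
    have := der_withinB (fd s ss) (gd s ss).
    by congr (der_within _ _ _ _); ring.
  by apply: der_within_subset sub _; exact: der_withinM.
rewrite {2}/e fg0 !subrr mul0r !subr0 => ee.
have : e t <= 0.
  rewrite ee mulr_le0_ge0 // /de.
  have -> : forall u w : R, u * (- w * u) + - w * u * u = - (2 * w * (u * u)).
    by move=> u w; ring.
  rewrite oppr_le0 mulr_ge0 //; last by rewrite -expr2 sqr_ge0.
  by rewrite mulr_ge0 // divr_ge0 // subr_ge0 (le_trans kt) // (le_trans ttau).
rewrite /e -expr2 => h; apply/eqP; rewrite -subr_eq0 -sqrf_eq0.
by rewrite eq_le h sqr_ge0.
Qed.

(** The solution of the linear equation closes the gap at T0, but it may meet [y] earlier, and the
    play ends there; so [T] is the first zero of the distance. An arbitrary play is compared with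
    this solution as soon as it is known to obey the same linear equation. *)
Lemma pursuer_catches : exists (T : R) (x : R -> 'rV[R]_n),
  [/\ 0 <= T, play_until x0 U y T x, x T = y T
    & forall (T' : R) (x' : R -> 'rV[R]_n), 0 <= T' -> play_until x0 U y T' x' ->
        T' <= T /\ (forall t : R, 0 <= t <= T' -> x' t = x t)].
Proof.
have sol i : exists x : R -> R, x 0 = x0 ord0 i /\
    forall t : R, 0 <= t < T0%:R ->
      is_derive t 1 x (m%:R / (T0%:R - t) * (y t ord0 i - x t)).
  have [t t0|x h1 h2] := @linear_solution R m T0%:R T0_gt0 (fun t => y t ord0 i) (x0 ord0 i).
    exact: y_cvg.
  by exists x.
have /choice[xi xiP] := sol.
(* The linear equation is singular at T0. Continuing by [y] from there on is continuous because the
   gap is less than (T0 - t) / K before. *)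
pose x (t : R) : 'rV[R]_n := if t < T0%:R then \row_i xi i t else y t.
have x00 : x 0 = x0.
  by rewrite /x T0_gt0; apply/rowP => i; rewrite mxE (xiP i).1.
have xd (D : set R) (t : R) i : 0 <= t < T0%:R -> der_within D (fun s => x s ord0 i) t
    ((m%:R / (T0%:R - t) *: (y t - x t)) ord0 i).
  move=> tT; have /andP[t0 tT'] := tT.
  apply: (@der_within_near R D (xi i) _ _ _ (T0%:R - t)); first by rewrite subr_gt0.
    move=> s; rewrite ltr_norml => /andP[_]; rewrite ltrBlDr subrK => sT.
    by rewrite /x sT mxE.
  rewrite /x tT' !mxE; apply: is_derive_der_within; exact: (xiP i).2.
have xc (D : set R) (t : R) i : 0 <= t < T0%:R ->
    x s ord0 i @[s --> within D (nbhs t)] --> x t ord0 i.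
  by move=> tT; apply: (der_within_cvg (xd D t i tT)).
have gap (t : R) : 0 <= t < T0%:R -> K%:R * enorm (y t - x t) < T0%:R - t.
  apply: barrier => // [s i sT|s /andP[s0 sT] _ i]; first exact: xc.
  by apply: xd; rewrite ltW.
have xcT i : {within `[0, T0%:R], continuous (fun s => x s ord0 i)}.
  apply/within_continuousP => t; rewrite /= in_itv /= => /andP[t0].
  rewrite le_eqVlt => /predU1P[tE|tT]; last by apply: xc; rewrite t0.
  have K1 : 1 <= K%:R :> R by rewrite ler1n.
  have := y_cvg (i := i) (@segment_ray R T0%:R) t0.
  move/withinP => hy; apply/withinP => e e0.
  have [r r_gt0 hr] := hy _ (divr_gt0 e0 (ltr0Sn R 1)).
  exists (Num.min r (e / 2)); first by rewrite lt_min r_gt0 divr_gt0.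
  move=> s; rewrite lt_min => Ds /andP[sr se]; have := hr s Ds sr.
  move: Ds; rewrite /= in_itv /= => /andP[s0 sT].
  have -> : x t ord0 i = y t ord0 i by rewrite /x tE ltxx.
  have [sT'|] := ltP s T0%:R; last first.
    by move=> Ts; rewrite /x [s < _]ltNge Ts /= => h; apply: lt_trans h _; lra.
  have := gap s; rewrite s0 sT' => /(_ isT) gs h.
  have gi : `|(y s - x s) ord0 i| < T0%:R - s.
    apply: le_lt_trans (coord_le_enorm _ i) _; apply: le_lt_trans gs.
    by rewrite ler_peMl ?enorm_ge0.
  rewrite !mxE in gi.
  move: se h gi; rewrite tE !ltr_norml => /andP[? ?] /andP[? ?] /andP[? ?].
  by apply/andP; split; lra.
have yc (D : set R) (t : R) i : D `<=` `[0, +oo[ -> 0 <= t ->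
  y s ord0 i @[s --> within D (nbhs t)] --> y t ord0 i by exact: y_cvg.
have dot00 : dot (0 : 'rV[R]_n) 0 = 0 by apply/eqP; rewrite dot_eq0.
(* [first_hit] finds the first nonnegative value; for minus the squared distance this is the first
   catch. *)
pose g (t : R) : R := -1 * dot (y t - x t) (y t - x t).
have [|||T [/andP[T_gt0 TT0] gT before]] := @first_hit R g 0 T0%:R (ltW T0_gt0).
- apply/within_continuousP => t Dt.
  have pc i : (y s - x s) ord0 i @[s --> within `[0, T0%:R] (nbhs t)] -->
      (y t - x t) ord0 i.
    under eq_cvg do rewrite !mxE.
    rewrite !mxE; apply: cvgB.
      by apply: yc; [exact: segment_ray|move: Dt; rewrite /= in_itv /= => /andP[]].
    exact: ((within_continuousP _ _).1 (xcT i)).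
  by apply: cvgM; [exact: cvg_cst|exact: cvg_dot].
- rewrite /g (proj1 yv) x00 mulN1r oppr_lt0 lt_def dot_ge0 dot_eq0 subr_eq0.
  by rewrite eq_sym x0_neq_y0.
- by rewrite /g /x ltxx subrr dot00 mulr0.
have xT : x T = y T.
  apply/eqP; rewrite eq_sym -subr_eq0 -dot_eq0; apply/eqP/oppr_inj.
  by rewrite oppr0 -mulN1r.
have xyN (t : R) : 0 <= t < T -> x t != y t.
  move=> /before; apply: contraTneq => e.
  by rewrite /g e subrr dot00 mulr0 ltxx.
have UL (t : R) : 0 <= t < T0%:R -> U t (x t) (y t) = m%:R / (T0%:R - t) *: (y t - x t).
  move=> tT; have /andP[_ tT'] := tT; apply: pursuit_linear => //.
  by apply/gauge_le; [rewrite subr_ge0 ltW|rewrite ltW ?gap].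
exists T, x; split => //; first exact: ltW.
- split => // [|t /andP[t0 tT]].
    apply/subspace_continuousP => t Dt; apply/cvg_row => i.
    apply: (within_subset_cvg (D := `[0, T0%:R])).
      by move=> s; rewrite /= !in_itv /= => /andP[-> st]; rewrite (le_trans st).
    apply: ((within_continuousP _ _).1 (xcT i)).
    by move: Dt; rewrite /= !in_itv /= => /andP[-> st]; rewrite (le_trans st).
  have tT0 : 0 <= t < T0%:R by rewrite t0 (lt_le_trans tT).
  split; first by apply: xyN; rewrite t0.
  by apply/has_derivative_within_coord => i; rewrite UL //; exact: xd.
move=> T' x' T'0 [x'0 x'c x'd].
have x'ci i : {within `[0, T'], continuous (fun s => x' s ord0 i)}.
  apply/within_continuousP => t Dt.
  by have := (subspace_continuousP _ _).1 x'c t Dt; move/cvg_row.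
pose tau := Num.min T' T0%:R.
have tauT' : tau <= T' by rewrite ge_min lexx.
have tauT0 : tau <= T0%:R by rewrite ge_min lexx orbT.
have sub' : `[0, tau] `<=` `[0, T'].
  by move=> s; rewrite /= !in_itv /= => /andP[-> st]; rewrite (le_trans st).
have sub0 : `[0, tau] `<=` `[0, T0%:R].
  by move=> s; rewrite /= !in_itv /= => /andP[-> st]; rewrite (le_trans st).
have x'sd (t : R) i : 0 <= t < tau -> der_within `[0, tau] (fun s => x' s ord0 i) t
    (U t (x' t) (y t) ord0 i).
  move=> /andP[t0 tt]; apply: der_within_subset sub' _.
  have [|_] := x'd t; first by rewrite t0 (lt_le_trans tt).
  by move/has_derivative_within_coord.
(* The law is known to be linear only where K |p| <= T0 - t, which is still to be shown for [x'].
   There is no circle: [barrier] uses the linear equation only at times of equality. *)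
have gap' (t : R) : 0 <= t < tau -> K%:R * enorm (y t - x' t) < T0%:R - t.
  apply: barrier => // [s i /andP[s0 st]|s /andP[s0 st] e i].
    apply: (within_subset_cvg sub'); apply: ((within_continuousP _ _).1 (x'ci i)).
    by rewrite /= in_itv /= s0 ltW // (lt_le_trans st).
  rewrite -pursuit_linear ?e //; last exact: lt_le_trans tauT0.
  by apply: x'sd; rewrite st ltW.
have same (t : R) : 0 <= t <= tau -> x' t = x t.
  move=> tt; apply/rowP => i.
  apply: (@linear_unique tau (fun s => x' s ord0 i) (fun s => x s ord0 i)
    (fun s => y s ord0 i)) => //.
  - apply/within_continuousP => s Ds; apply: (within_subset_cvg sub').
    by apply: ((within_continuousP _ _).1 (x'ci i)); exact: sub'.
  - apply/within_continuousP => s Ds; apply: (within_subset_cvg sub0).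
    by apply: ((within_continuousP _ _).1 (xcT i)); exact: sub0.
  - by rewrite x'0 x00.
  - move=> s /andP[s0 st]; have ss : 0 <= s < tau by rewrite ltW.
    have sT0 : s < T0%:R by exact: lt_le_trans tauT0.
    have := x'sd s i ss; rewrite pursuit_linear //; first by rewrite !mxE.
    by apply/gauge_le; [rewrite subr_ge0 ltW|rewrite ltW ?gap'].
  - move=> s /andP[s0 st].
    have ss : 0 <= s < T0%:R by rewrite (ltW s0) (lt_le_trans st).
    by have := xd `[0, tau] s i ss; rewrite !mxE.
(* If the play went on after [T], it would agree at [T] with [x], hence with [y], although no catch
   is allowed before its end. *)
have T'T : T' <= T.
  rewrite leNgt; apply/negP => TT'.
  have [] := x'd T; first by rewrite ltW.
  rewrite same ?xT ?eqxx // ltW //=.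
  by rewrite le_min (ltW TT') TT0.
split => // t /andP[t0 tT']; apply: same.
by rewrite t0 le_min tT' (le_trans tT') // (le_trans T'T).
Qed.

End Chase.

Theorem proposition9 (R : realType) (n : nat) (a b : R) (x0 y0 : 'rV[R]_n)
    (n_ge1 : (1 <= n)%N) (a_ge0 : 0 <= a) (b_ge0 : 0 <= b)
    (a_comp : computable_real a) (b_comp : computable_real b)
    (x0_comp : computable_point x0) (y0_comp : computable_point y0)
    (x0_neq_y0 : x0 != y0) :
  (a <= b -> exists v : R -> 'rV[R]_n,
               evader_open_loop_winning a b x0 y0 v) /\
  (a > b -> exists U : R -> 'rV[R]_n -> 'rV[R]_n -> 'rV[R]_n,
              pursuer_positional_winning a b x0 y0 U).
Proof.
split=> [ab|ba].
- have [i0 i0P] : exists i, (y0 - x0) ord0 i != 0.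
    apply/existsP; apply: contraNT x0_neq_y0 => /existsPn h.
    rewrite eq_sym -subr_eq0; apply/eqP/rowP => i; rewrite [RHS]mxE.
    by apply/eqP; rewrite -[_ == _]negbK h.
  pose neg := (y0 - x0) ord0 i0 < 0.
  pose w : 'rV[R]_n := ((-1) ^+ neg * b) *: delta_mx ord0 i0.
  have wb : enorm w = b.
    by rewrite enorm_axis normrM normrX normrN1 expr1n mul1r ger0_norm.
  exists (fun=> w); split.
    by split=> [|t _]; [exact: computable_axis|rewrite wb].
  move=> u [_ ua] x y tx ty t t0.
  apply: (@evader_escape R n a b x0 y0 w u) => //; first by rewrite a_ge0.
  rewrite dotZr /dot (bigD1 i0) //= big1 ?addr0.
    rewrite [delta_mx _ _ _ _]mxE !eqxx mulr1 mulrAC mulr_ge0 //.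
    rewrite /neg; case: ltP => h; last by rewrite mul1r.
    by rewrite mulN1r oppr_ge0 ltW.
  by move=> j ji; rewrite [delta_mx _ _ _ _]mxE (negPf ji) andbF mulr0.
(* With 2 < K (a - b), the integer part m of a K satisfies m - 1 > a K - 2 > b K. *)
pose K := (Num.truncn (2 / (a - b))).+1%N.
have K_gt0 : (0 < K)%N by [].
have Kab : 2 < K%:R * (a - b).
  by rewrite -ltr_pdivrMr ?subr_gt0 //; exact: truncnS_gt.
pose m := Num.truncn (a * K%:R).
have /andP[mle mgt] : m%:R <= a * K%:R < m.+1%:R.
  by apply: truncn_itv; rewrite mulr_ge0.
have slow : K%:R * b < m%:R - 1 by move: mgt Kab; rewrite -natr1; clear; lra.
have m_gt0 : (0 < m)%N.
  rewrite lt0n; apply/eqP => m0; move: slow; rewrite m0.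
  have : 0 <= K%:R * b by rewrite mulr_ge0.
  by clear; lra.
pose T0 := (Num.truncn (K%:R * enorm (y0 - x0))).+1%N.
exists (pursuit m K T0); split.
  split=> [|t x y _ xy]; first exact: pursuit_computable.
  apply: le_trans (pursuit_bound _ _ _ K_gt0 xy) _.
  by rewrite ler_pdivrMr // ltr0n.
move=> v [_ vb] y yv.
exact: (@pursuer_catches R n m K T0 b x0 y0 v y K_gt0 slow (truncnS_gt _) x0_neq_y0 vb yv).
Qed.
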